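(* Let $\bar\mu$ be a translation-invariant product probability measure on $\mathbb N^{\mathbb Z^d}$ whose single site marginal $\mu$ satisfies $\mu(\alpha)>0$ for all $\alpha\in\mathbb N$. Consider a mass migration target process (MM-TP) on $\mathbb Z^d$ with rates $p(x,y)g^k_{*,\beta}$ for an asymmetric $p(\cdot,\cdot)$. Assume that either there is $C>0$ with $\sum_{k=1}^\alpha k\,g^k_{*,\beta}\le C(\alpha+\beta)$ for all $\alpha>0,\beta\ge0$ and $\mu$ has a finite first moment, or the alternative assumptions (A1)–(A2) (stated in the context) are satisfied. Then $\bar\mu$ is invariant for the MM-TP if and only if $$g^\alpha_{*,\beta}=g^\alpha_{*,0}+\frac1{\mu(\beta)}\sum_{k=1}^\beta H_\alpha(\beta,k)\,g^k_{*,0}\qquad\text{for all }\alpha\ge1,\ \beta\ge1,$$ where the $H_\alpha(\beta,k)$ depend only on $\mu$ and are the solution of the recurrence relations $$H_\alpha(\beta,\beta)=\Delta_\alpha(\beta)\mu(0)\ \text{ for }\beta\ge1,$$ $$H_\alpha(\beta,k)=\Delta_\alpha(k)\mu(\beta-k)+\sum_{l=1}^{\beta-k}\Delta_\alpha(l)H_l(\beta-l,k)\ \text{ for }\beta\ge2,\ 1\le k\le\beta-1,$$ with, for all $r>0$ and $s\ge0$, $\ \Delta_r(s)=\dfrac{\mu(r+s)}{\mu(r)}-\dfrac{\mu(r+s-1)}{\mu(r-1)}$.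
   Context: $\mathbb N=\{0,1,2,\dots\}$ and $X=\mathbb Z^d$. Mass migration process (MMP): $p(\cdot,\cdot)$ is an irreducible translation-invariant transition probability on $\mathbb Z^d$ (asymmetric if $p(x,y)\ne p(y,x)$ for some $x,y$). The rates are numbers $g^k_{\alpha,\beta}\ge0$ with $g^0_{\alpha,\beta}=0$ and $g^k_{\alpha,\beta}=0$ if $k>\alpha$ or $\alpha=0$; $k$ particles jump together from $x$ to $y$ at rate $p(x,y)g^k_{\eta(x),\eta(y)}$. An MM-TP is an MMP with $g^k_{\alpha,\beta}=\mathbf 1_{[k\le\alpha]}g^k_{*,\beta}$, where $g^k_{*,\beta}\ge0$ depends on $k\ge1$ and $\beta$ only. Fix a positive function $a$ on $X$ and $M>0$ with $\sum_yp(x,y)a_y+\sum_ya_yp(y,x)\le Ma_x$ for all $x$, and $\sum_xa_x<\infty$. Set $\|\eta\|=\sum_x\eta(x)a_x$, $\|\eta-\zeta\|=\sum_x|\eta(x)-\zeta(x)|a_x$, $\mathfrak X=\{\eta\in\mathbb N^X:\|\eta\|<\infty\}$, and let $\mathbf L$ be the set of $f:\mathfrak X\to\mathbb R$ such that $|f(\eta)-f(\zeta)|\le L_f\|\eta-\zeta\|$ for some $L_f>0$. Generator: $\mathcal Lf(\eta)=\sum_{x,y}\sum_{k>0}p(x,y)g^k_{\eta(x),\eta(y)}\big(f(\mathcal S^k_{x,y}\eta)-f(\eta)\big)$, where $\mathcal S^k_{x,y}\eta$ is $\eta$ with $k$ particles moved from $x$ to $y$ if $\eta(x)\ge k$ and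 $x\neq y$, and $\eta$ otherwise. The process is assumed constructed, i.e. there is a Markov semigroup $(S(t))_{t\ge0}$ on $\mathbf L$ such that for $f\in\mathbf L$, $\eta\in\mathfrak X$: $S(t_1+t_2)=S(t_1)S(t_2)$, $S(0)=I$; $S(t)f(\eta)=f(\eta)+\int_0^t\mathcal LS(s)f(\eta)\,ds$; $|S(t)f(\eta)-f(\eta)|\le\|\eta\|L_f(e^{ct}-1)$ for a constant $c>0$; $S(t)f(\eta)$ and $\mathcal LS(t)f(\eta)$ are continuous in $t$; $\lim_{t\searrow0}(S(t)f(\eta)-f(\eta))/t=\mathcal Lf(\eta)$; $\mathcal LS(t)f(\eta)=S(t)\mathcal Lf(\eta)$. (Under (A1) below another construction is allowed.) A probability measure $\bar\mu$ on $\mathbb N^X$ is invariant if it is supported on $\mathfrak X$ and $\int S(t)f\,d\bar\mu=\int f\,d\bar\mu$ for every bounded $f\in\mathbf L$ and $t\ge0$. Alternative assumptions: (A1) a probability measure $\bar\mu$ on $\mathbb N^X$ is called invariant when $\int S(t)f\,d\bar\mu=\int f\,d\bar\mu$ for every bounded $f\in\mathbf L$, $t\ge0$, and this is equivalent to $\int\mathcal Lf\,d\bar\mu=0$ for every bounded cylinder function $f$ on $\mathbb N^X$; (A2) there is $C>0$ with $\sum_{k\le\alpha}g^k_{\alpha,\beta}\le C$ for all $\alpha,\beta$. *)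

(* Defs.v *)
From HB Require Import structures.
From mathcomp Require Export all_boot all_order all_algebra.
From mathcomp Require Export all_classical all_reals all_analysis.
Export Order.TTheory GRing.Theory Num.Theory numFieldNormedType.Exports.

Set Implicit Arguments.
Unset Strict Implicit.
Unset Printing Implicit Defensive.

Local Open Scope classical_set_scope.
Local Open Scope ring_scope.

Definition lattice (d : nat) := 'rV[int]_d.

Definition conf (d : nat) := lattice d -> nat.

(* The product sigma-algebra on conf d; as a type, confM d is conf d. *)
Definition coordinate_events (d : nat) : set (set (conf d)) :=
  [set A | exists (x : lattice d) (n : nat), A = [set eta | eta x = n]].

Definition confM (d : nat) := g_sigma_algebraType (@coordinate_events d).

Section SignedSum.
Variables (R : realType) (I : choiceType).

(* \esum is meant for nonnegative families: the two signs are summed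
   separately. The value is 0 if one of the two sums is infinite. *)
Definition rsum (A : set I) (u : I -> R) : R :=
  fine (\esum_(i in A) (Num.max (u i) 0)%:E
        - \esum_(i in A) (Num.max (- u i) 0)%:E)%E.

End SignedSum.

Section Transition.
Variables (R : realType) (d : nat).
Implicit Types p : lattice d -> lattice d -> R.

Definition transition_probability p : Prop :=
  (forall x y, 0 <= p x y) /\
  (forall x, \esum_(y in [set: lattice d]) (p x y)%:E = 1%E).

Definition translation_invariant_kernel p : Prop :=
  forall x y z, p (x + z) (y + z) = p x y.

Fixpoint n_step p (n : nat) (x y : lattice d) : \bar R :=
  match n with
  | 0 => ((x == y)%:R)%:E
  | m.+1 => \esum_(z in [set: lattice d]) ((p x z)%:E * n_step p m z y)%E
  end.

Definition irreducible_kernel p : Prop :=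
  forall x y, exists n, (0 < n_step p n x y)%E.

Definition asymmetric_kernel p : Prop := exists x y, p x y != p y x.

(* sum_y p(x,y) a_y + sum_y a_y p(y,x) <= M a_x, and sum_x a_x < oo *)
Definition admissible_weight p (a : lattice d -> R) (M : R) : Prop :=
  [/\ forall x, 0 < a x,
      0 < M,
      forall x, (\esum_(y in [set: lattice d]) (p x y * a y)%:E
                 + \esum_(y in [set: lattice d]) (a y * p y x)%:E
                 <= (M * a x)%:E)%E
    & (\esum_(x in [set: lattice d]) (a x)%:E < +oo)%E].

End Transition.

Section Configurations.
Variables (R : realType) (d : nat) (a : lattice d -> R).
Implicit Types (eta zeta : conf d) (f : conf d -> R) (E : set (conf d)).

Definition cnorm eta : \bar R :=
  \esum_(x in [set: lattice d]) ((eta x)%:R * a x)%:E.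

Definition cdist eta zeta : \bar R :=
  \esum_(x in [set: lattice d]) (`|(eta x)%:R - (zeta x)%:R| * a x)%:E.

Definition finite_confs : set (conf d) := [set eta | (cnorm eta < +oo)%E].

Definition lipschitz_with E (L : R) f : Prop :=
  0 < L /\
  forall eta zeta, E eta -> E zeta ->
    (`|f eta - f zeta|%:E <= L%:E * cdist eta zeta)%E.

(* A function on a set E of configurations is represented by a function on
   conf d whose values outside E are irrelevant. The class L of functions on
   the configurations of finite norm is Lip finite_confs; on
   Lip [set: conf d], the distance may take the value +oo. *)
Definition Lip E : set (conf d -> R) :=
  [set f | exists L, lipschitz_with E L f].

Definition bounded_fun_on E : set (conf d -> R) :=
  [set f | exists B : R, forall eta, E eta -> `|f eta| <= B].

Definition cylinder_fun : set (conf d -> R) :=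
  [set f | exists s : seq (lattice d),
     forall eta zeta, {in s, eta =1 zeta} -> f eta = f zeta].

Definition measurable_conf_fun : set (conf d -> R) :=
  [set f | measurable_fun [set: confM d] (f : confM d -> R)].

End Configurations.

Section Generator.
Variables (R : realType) (d : nat) (p : lattice d -> lattice d -> R).

(* g k alpha beta is the rate of a jump of k particles from a site with alpha
   particles to a site with beta particles. *)
Definition MMP_rates (g : nat -> nat -> nat -> R) : Prop :=
  [/\ forall k alpha beta, 0 <= g k alpha beta,
      forall alpha beta, g 0%N alpha beta = 0
    & forall k alpha beta, ((alpha < k)%N || (alpha == 0%N)) ->
        g k alpha beta = 0].

Definition MMTP_rates (gs : nat -> nat -> R) (k alpha beta : nat) : R :=
  if (0 < k <= alpha)%N then gs k beta else 0.

Lemma MMTP_ratesP (gs : nat -> nat -> R) :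
  (forall k beta, (0 < k)%N -> 0 <= gs k beta) -> MMP_rates (MMTP_rates gs).
Proof.
move=> gs0; rewrite /MMTP_rates; split=> // k alpha beta.
  by case: ifP => // /andP[/gs0].
by case: ifP => // /andP[k0 ka]; rewrite ltnNge ka /= => /eqP a0;
  rewrite a0 leqNgt k0 in ka.
Qed.

Definition move (k : nat) (x y : lattice d) (eta : conf d) : conf d :=
  if (k <= eta x)%N && (x != y) then
    fun z => if z == x then (eta x - k)%N
             else if z == y then (eta y + k)%N else eta z
  else eta.

Definition generator (g : nat -> nat -> nat -> R) (f : conf d -> R)
    (eta : conf d) : R :=
  rsum [set i : lattice d * lattice d * nat | (0 < i.2)%N]
    (fun i => let: (x, y, k) := i in
       p x y * g k (eta x) (eta y) * (f (move k x y eta) - f eta)).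

End Generator.

Section Semigroup.
Variables (R : realType) (d : nat).
Implicit Types (E : set (conf d)) (D : set (conf d -> R))
  (S : R -> (conf d -> R) -> (conf d -> R)).

Record markov_semigroup E D S : Prop := MarkovSemigroup {
  msg_dom1 : D (fun=> 1);
  msg_domP : forall (c : R) f h, D f -> D h ->
    D (fun eta => c * f eta + h eta);
  msg_stable : forall t f, 0 <= t -> D f -> D (S t f);
  msg_linear : forall t (c : R) f h, 0 <= t -> D f -> D h ->
    forall eta, E eta ->
      S t (fun zeta => c * f zeta + h zeta) eta = c * S t f eta + S t h eta;
  msg_pos : forall t f, 0 <= t -> D f -> (forall eta, E eta -> 0 <= f eta) ->
    forall eta, E eta -> 0 <= S t f eta;
  msg_1 : forall t, 0 <= t -> forall eta, E eta -> S t (fun=> 1) eta = 1;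
  msg_0 : forall f, D f -> forall eta, E eta -> S 0 f eta = f eta;
  msg_add : forall t1 t2 f, 0 <= t1 -> 0 <= t2 -> D f ->
    forall eta, E eta -> S (t1 + t2) f eta = S t1 (S t2 f) eta
}.

Variables (p : lattice d -> lattice d -> R) (a : lattice d -> R)
  (g : nat -> nat -> nat -> R).

Let X := finite_confs a.
Let Lf := generator p g.

(* For f in Lip X, the function Lf f need not be in Lip X, but S t (Lf f)
   appears below: the semigroup acts on a space D containing both. *)
Record constructed_on_X S : Prop := ConstructedOnX {
  con_markov : exists D, [/\ markov_semigroup X D S,
    Lip a X `<=` D & forall f, Lip a X f -> D (Lf f)];
  con_stable : forall t f, 0 <= t -> Lip a X f -> Lip a X (S t f);
  con_integral : forall t f eta, 0 <= t -> Lip a X f -> X eta ->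
    S t f eta =
    f eta + \int[lebesgue_measure]_(s in `[0, t]) Lf (S s f) eta;
  con_growth : exists2 c : R, 0 < c &
    forall t f L eta, 0 <= t -> lipschitz_with a X L f -> X eta ->
      (`|S t f eta - f eta|%:E
        <= cnorm a eta * (L * (expR (c * t) - 1))%:E)%E;
  con_continuous : forall f eta, Lip a X f -> X eta ->
    {within `[0, +oo[, continuous (fun t : R => S t f eta)};
  con_gen_continuous : forall f eta, Lip a X f -> X eta ->
    {within `[0, +oo[, continuous (fun t : R => Lf (S t f) eta)};
  con_derivative : forall f eta, Lip a X f -> X eta ->
    (S t f eta - f eta) / t @[t --> 0^'+] --> Lf f eta;
  con_commute : forall t f eta, 0 <= t -> Lip a X f -> X eta ->
    Lf (S t f) eta = S t (Lf f) eta
}.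

Definition preserves E (F : set (conf d -> R)) S
    (nu : probability (confM d) R) : Prop :=
  forall f, F f -> forall t, 0 <= t ->
    (\int[nu]_(eta in (E : set (confM d))) (S t f eta)%:E
     = \int[nu]_(eta in (E : set (confM d))) (f eta)%:E)%E.

Definition invariant_on_X S (nu : probability (confM d) R) : Prop :=
  nu X = 1%E /\ preserves X (Lip a X `&` bounded_fun_on X) S nu.

(* Test functions when the process lives on all of conf d.
   Unlike on X, a Lipschitz function on conf d may fail to be measurable. *)
Definition bounded_Lip_conf : set (conf d -> R) :=
  Lip a setT `&` bounded_fun_on setT `&` @measurable_conf_fun R d.

Definition invariant_on_conf S (nu : probability (confM d) R) : Prop :=
  preserves setT bounded_Lip_conf S nu.

Definition assumption_A1 S : Prop :=
  (exists D, [/\ markov_semigroup setT D S, bounded_Lip_conf `<=` D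
     & D `<=` @measurable_conf_fun R d]) /\
  (forall nu : probability (confM d) R,
     invariant_on_conf S nu <->
     (forall f, cylinder_fun f -> bounded_fun_on setT f ->
        \int[nu]_eta (Lf f eta)%:E = 0)%E).

Definition assumption_A2 : Prop :=
  exists2 C : R, 0 < C &
    forall alpha beta, \sum_(0 <= k < alpha.+1) g k alpha beta <= C.

End Semigroup.

Section ProductMeasure.
Variables (R : realType) (d : nat).
Implicit Types nu : probability (confM d) R.

Definition product_measure nu : Prop :=
  forall (s : seq (lattice d)) (n : lattice d -> nat), uniq s ->
    nu [set eta : conf d | forall x, x \in s -> eta x = n x]
    = (\prod_(x <- s) nu [set eta : conf d | eta x = n x])%E.

Definition translation_invariant_measure nu : Prop :=
  forall (z : lattice d) (A : set (confM d)), measurable A ->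
    nu [set eta : conf d | A (fun x => eta (x + z))] = nu A.

Definition site_marginal nu (mu : nat -> R) : Prop :=
  forall x n, nu [set eta : conf d | eta x = n] = (mu n)%:E.

End ProductMeasure.

Section Target.
Variables (R : realType).
Implicit Types (mu : nat -> R) (gs : nat -> nat -> R).

Definition finite_first_moment mu : Prop :=
  (\sum_(0 <= n <oo) (n%:R * mu n)%:E < +oo)%E.

Definition MMTP_growth gs : Prop :=
  exists2 C : R, 0 < C &
    forall alpha beta, (0 < alpha)%N ->
      \sum_(1 <= k < alpha.+1) k%:R * gs k beta <= C * (alpha + beta)%:R.

(* Used for r > 0 only. *)
Definition Delta mu (r s : nat) : R :=
  mu (r + s)%N / mu r - mu (r + s).-1 / mu r.-1.

(* H alpha beta k stands for H_alpha(beta, k). *)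
Definition H_recurrence mu (H : nat -> nat -> nat -> R) : Prop :=
  (forall alpha beta, (0 < alpha)%N -> (0 < beta)%N ->
     H alpha beta beta = Delta mu alpha beta * mu 0%N) /\
  (forall alpha beta k, (0 < alpha)%N -> (1 < beta)%N ->
     (0 < k <= beta.-1)%N ->
     H alpha beta k = Delta mu alpha k * mu (beta - k)%N
       + \sum_(1 <= l < (beta - k).+1)
           Delta mu alpha l * H l (beta - l)%N k).

End Target.

(* Main.v *)
Require Import Defs.
From mathcomp Require Import measurable_realfun ring lra zify.
Set Implicit Arguments.
Unset Strict Implicit.
Unset Printing Implicit Defensive.
Local Open Scope classical_set_scope.
Local Open Scope ring_scope.

(** Write [out_rate a b] for the total rate of jumps from a site with [a]
    particles to a site with [b] particles, and [in_rate a b] for the total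
    rate of jumps that end in the pair state [(a, b)], each multiplied by the
    weight of its starting pair and divided by the weight of [(a, b)] under the
    product of two copies of [mu]. Changing variables in the gain part of the
    generator (lemma [integral_jump]) gives, for a bounded cylinder function f,

      E[L f] = sum over x <> y of
                 p(x, y) E[f(eta) (in_rate - out_rate)(eta x, eta y)],

    where only the pairs that meet the support of f count
    ([generator_gain_loss]).

    Suppose that this vanishes for the indicators of cylinder events. One site
    shows that the averages of [in_rate - out_rate] over its first and over
    its second argument are opposite functions. Two sites x, y with
    p(x, y) <> p(y, x) then give a two by two linear system with a nonzero
    determinant, which forces
    (in_rate - out_rate)(a, b) = phi a - phi b for a function phi
    ([balanced_necessary]). Putting b = 0, where [in_rate] vanishes, identifies
    phi a with - out_rate a 0 up to a constant: this is [balanced].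
    Conversely, under [balanced] the expectation is a sum of
    p(x, y) (v x - v y), which telescopes because the rows and the columns of p
    have the same sum ([balanced_sufficient]).

    The increment of [balanced] in its first argument is a recurrence that
    expresses the rates at target occupation b by those at smaller target
    occupations ([source_recurrence]), and H is by construction the kernel that
    solves it ([source_recurrenceP]). The increments lose the values at a = 0;
    these come back from the conservation of mass in a jump: the sum over
    a + b = n of mu a * mu b * (in_rate - out_rate)(a, b) is zero for each n
    ([net_rate_conserved]).

    It remains to link invariance with E[L f] = 0. When the process lives on
    the whole of the configuration space, the link is assumed. When it is
    constructed on the configurations of finite norm, differentiating
    E[S(t) f] at t = 0 under the expectation gives one direction. For the other
    one, E[L f] = 0 is extended from cylinder functions to bounded Lipschitz
    functions by truncating configurations ([balanced_Lip_expectation0]). Then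
    t |-> E[S(t) f] is continuous and has zero right derivative everywhere,
    since S(t) f is again bounded and Lipschitz; such a function is constant
    ([zero_right_derivative_cst]). All the dominations come from the growth of
    the rates, which makes |L f| at most a constant times the norm of the
    configuration, whose expectation is finite when [mu] has a first moment. *)

(** * Algebra of the exchange rates *)

Section Algebra.
Variables (R : realType) (mu : nat -> R) (gs : nat -> nat -> R).
Hypothesis mu_gt0 : forall n, 0 < mu n.

Definition out_rate (a b : nat) : R := \sum_(1 <= k < a.+1) gs k b.

(** The [k]-th term is the rate of the jump of [k] particles from the pair state
    [(a + k, b - k)] to [(a, b)], times the ratio of the weights of these two
    states under the product of two copies of [mu]. *)
Definition in_rate (a b : nat) : R :=
  \sum_(1 <= k < b.+1)
    gs k (b - k)%N * (mu (a + k)%N * mu (b - k)%N / (mu a * mu b)).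

(** With [h a = - out_rate a 0], the right-hand side is [h a - h b]: the net
    rate of entering a pair state is a difference of one-site functions. *)
Definition balanced : Prop := forall a b,
  in_rate a b - out_rate a b = out_rate b 0 - out_rate a 0.

(** The increment of [balanced] between [a - 1] and [a]. The sum only involves
    rates towards targets with fewer than [b] particles, so the equations
    determine [gs] from the rates [gs k 0]. *)
Definition source_recurrence : Prop := forall a b, (0 < a)%N ->
  gs a b = gs a 0%N + (mu b)^-1 *
    \sum_(1 <= k < b.+1) Delta mu a k * (mu (b - k)%N * gs k (b - k)%N).

Lemma triangle_exchange (F : nat -> nat -> R) n :
  \sum_(1 <= l < n.+1) \sum_(1 <= k < (n - l).+1) F l k =
  \sum_(1 <= k < n.+1) \sum_(1 <= l < (n - k).+1) F l k.
Proof.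
transitivity (\sum_(1 <= l < n.+1) \sum_(1 <= k < n.+1 | (k + l <= n)%N) F l k).
  apply: eq_big_nat => l hl.
  rewrite [LHS](big_nat_widen _ _ n.+1); last lia.
  by rewrite [LHS]big_nat_cond [RHS]big_nat_cond; apply: eq_bigl => k; lia.
rewrite (exchange_big_dep_nat xpredT)//=; apply: eq_big_nat => k hk.
rewrite [RHS](big_nat_widen _ _ n.+1); last lia.
by rewrite [LHS]big_nat_cond [RHS]big_nat_cond; apply: eq_bigl => l; lia.
Qed.

Lemma antidiagonal_exchange (F : nat -> nat -> R) n :
  \sum_(0 <= b < n.+1) \sum_(1 <= k < b.+1) F k (b - k)%N =
  \sum_(0 <= c < n.+1) \sum_(1 <= k < (n - c).+1) F k c.
Proof.
transitivity (\sum_(0 <= b < n.+1) \sum_(0 <= c < n.+1 | (c < b)%N) F (b - c)%N c).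
  apply: eq_big_nat => b hb.
  rewrite big_nat_rev/= add1n [LHS]big_add1/=.
  transitivity (\sum_(0 <= c < b) F (b - c)%N c).
    by apply: eq_big_nat => c hc; congr F; lia.
  rewrite [LHS](big_nat_widen _ _ n.+1); last lia.
  by rewrite [LHS]big_nat_cond [RHS]big_nat_cond; apply: eq_bigl => k; lia.
rewrite (exchange_big_dep_nat xpredT)//=; apply: eq_big_nat => c hc.
rewrite -(big_nat_widenl c.+1 0 n.+1 xpredT)//.
rewrite -{1}(add0n c.+1) big_addn big_add1/=.
rewrite (_ : (n.+1 - c.+1 = n - c)%N); last lia.
by apply: eq_big_nat => k hk; congr F; lia.
Qed.

Section Recurrence.
Variable H : nat -> nat -> nat -> R.
Hypothesis H_rec : H_recurrence mu H.

Lemma H_recE a b k : (0 < a)%N -> (0 < k <= b)%N ->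
  H a b k = Delta mu a k * mu (b - k)%N
       + \sum_(1 <= l < (b - k).+1) Delta mu a l * H l (b - l)%N k.
Proof.
move=> a0 /andP[k0 kb]; have [H1 H2] := H_rec.
have [->|kneb] := eqVneq k b.
  by rewrite subnn big_geq// addr0 H1//; lia.
by apply: H2 => //; lia.
Qed.

(** One step of the induction that solves [source_recurrence]: once the rates at
    target occupations below [b] are expressed by [H] and the rates [gs k 0],
    collecting the coefficient of [gs k 0] reproduces the recurrence that
    defines [H a b k]. *)
Lemma sum_H a b : (0 < a)%N ->
  (forall l, (0 < l <= b)%N -> mu (b - l)%N * gs l (b - l)%N =
     mu (b - l)%N * gs l 0%N +
     \sum_(1 <= k < (b - l).+1) H l (b - l)%N k * gs k 0%N) ->
  \sum_(1 <= k < b.+1) Delta mu a k * (mu (b - k)%N * gs k (b - k)%N) =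
  \sum_(1 <= k < b.+1) H a b k * gs k 0%N.
Proof.
move=> a0 IH.
transitivity (\sum_(1 <= l < b.+1) Delta mu a l * mu (b - l)%N * gs l 0%N +
   \sum_(1 <= l < b.+1) \sum_(1 <= k < (b - l).+1)
      Delta mu a l * H l (b - l)%N k * gs k 0%N).
  rewrite -big_split/=; apply: eq_big_nat => l hl.
  rewrite IH// mulrDr mulrA big_distrr/=; congr (_ + _).
  by apply: eq_bigr => k _; rewrite mulrA.
rewrite triangle_exchange -big_split/=; apply: eq_big_nat => k hk.
by rewrite H_recE// [RHS]mulrDl big_distrl.
Qed.

Lemma source_recurrenceP : source_recurrence <->
  (forall a b, (1 <= a)%N -> (1 <= b)%N ->
      gs a b = gs a 0%N
        + (mu b)^-1 * \sum_(1 <= k < b.+1) H a b k * gs k 0%N).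
Proof.
have mn0 n : mu n != 0 by rewrite gt_eqF.
have extend b :
    (forall a, (0 < a)%N -> gs a b = gs a 0%N
        + (mu b)^-1 * \sum_(1 <= k < b.+1) H a b k * gs k 0%N) ->
    forall a, (0 < a)%N -> mu b * gs a b = mu b * gs a 0%N +
      \sum_(1 <= k < b.+1) H a b k * gs k 0%N.
  by move=> h a a0; rewrite h// mulrDr mulrA divff// mul1r.
split=> [h a b a1 b1|h a b a0].
  rewrite h//; congr (_ + _ * _).
  have {b1} : (0 < a)%N by [].
  elim/ltn_ind: b a {a1} => b IH a a0.
  apply: sum_H => // l /andP[l0 lb]; apply: extend => // a' a'0.
  rewrite h// IH//; lia.
have [->|b0] := posnP b; first by rewrite big_geq// mulr0 addr0.
rewrite h//; congr (_ + _ * _).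
apply/esym/sum_H => // l /andP[l0 lb]; apply: extend => // a' a'0.
have [->|bl0] := posnP (b - l); first by rewrite big_geq// mulr0 addr0.
exact: h.
Qed.

End Recurrence.

Lemma out_rateS a b : out_rate a.+1 b = out_rate a b + gs a.+1 b.
Proof. by rewrite /out_rate big_nat_recr. Qed.

Lemma in_rate0 a : in_rate a 0 = 0.
Proof. by rewrite /in_rate big_geq. Qed.

Lemma out_rate0 b : out_rate 0 b = 0.
Proof. by rewrite /out_rate big_geq. Qed.

Lemma in_rateS a b : in_rate a.+1 b - in_rate a b =
  (mu b)^-1 * \sum_(1 <= k < b.+1)
     Delta mu a.+1 k * (mu (b - k)%N * gs k (b - k)%N).
Proof.
rewrite /in_rate -sumrB big_distrr/=; apply: eq_big_nat => k hk.
have mn0 n : mu n != 0 by rewrite gt_eqF.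
rewrite /Delta addSn/=; field; rewrite ?mn0//.
Qed.

(** A jump from [(a, b)] leads to [(a - k, b + k)], on the same antidiagonal.
    Hence gains and losses cancel on each antidiagonal. *)
Lemma net_rate_conserved n :
  \sum_(0 <= b < n.+1) mu (n - b)%N * mu b *
     (in_rate (n - b) b - out_rate (n - b) b) = 0.
Proof.
have mn0 m : mu m != 0 by rewrite gt_eqF.
under eq_bigr do rewrite mulrBr.
rewrite sumrB; apply/eqP; rewrite subr_eq0; apply/eqP.
pose F k c := gs k c * (mu (n - c)%N * mu c).
transitivity (\sum_(0 <= b < n.+1) \sum_(1 <= k < b.+1) F k (b - k)%N).
  apply: eq_big_nat => b hb; rewrite /in_rate big_distrr/=.
  apply: eq_big_nat => k hk.
  rewrite /F (_ : (n - (b - k) = n - b + k)%N); last lia.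
  by field; rewrite !mn0.
rewrite antidiagonal_exchange; apply: eq_big_nat => c hc.
rewrite /out_rate big_distrr/=; apply: eq_bigr => k _.
by rewrite mulrC.
Qed.

(** Increments in [a] determine [in_rate a b - out_rate a b] only up to the
    defect [in_rate 0 b - out_rate 0 b - out_rate b 0]. By
    [net_rate_conserved] and the antisymmetry of [out_rate b 0 - out_rate a 0],
    the sum of [mu (n - b) * mu b] times this defect over [b <= n] vanishes for
    each [n]; since [mu] is positive, the defect is zero by induction. *)
Lemma balancedP : balanced <-> source_recurrence.
Proof.
have mn0 m : mu m != 0 by rewrite gt_eqF.
split=> [bal [//|a] b _|rec].
  have := bal a.+1 b; have := bal a b; have := in_rateS a b.
  rewrite !out_rateS; lra.
pose net a b := in_rate a b - out_rate a b.
have netE a b : net a b = net 0%N b - out_rate a 0.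
  elim: a => [|a IH]; first by rewrite out_rate0 subr0.
  move: IH; rewrite /net !out_rateS; have := in_rateS a b.
  have := @rec a.+1 b isT; lra.
suff e0 b : net 0%N b = out_rate b 0.
  by move=> a b; rewrite -/(net a b) netE e0.
have sum0 n : \sum_(0 <= c < n.+1) mu (n - c)%N * mu c *
    (net 0%N c - out_rate c 0) = 0.
  have := net_rate_conserved n.
  under eq_bigr do rewrite -/(net _ _) netE.
  move=> h; apply: etrans h; apply/eqP; rewrite -subr_eq0 -sumrB; apply/eqP.
  under eq_bigr do rewrite -mulrBr.
  transitivity (\sum_(0 <= c < n.+1) mu (n - c)%N * mu c * out_rate (n - c) 0 -
     \sum_(0 <= c < n.+1) mu (n - c)%N * mu c * out_rate c 0).
    by rewrite -sumrB; apply: eq_bigr => c _; ring.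
  apply/eqP; rewrite subr_eq0; apply/eqP; rewrite big_nat_rev/=.
  apply: eq_big_nat => c hc.
  by rewrite add0n subSS subKn ?(mulrC (mu c))//; lia.
(* In [sum0 b] the term [c = b] is the only one not yet known to vanish. *)
elim/ltn_ind: b => b IH.
have := sum0 b; rewrite big_nat_recr//= big_nat_cond big1 ?add0r; last first.
  by move=> c; rewrite andbT => /IH ->; rewrite subrr mulr0.
move/eqP; rewrite !mulf_eq0 (negPf (mn0 _)) (negPf (mn0 _))/= subr_eq0.
by move/eqP.
Qed.

Lemma balanced_rate_relation (H : nat -> nat -> nat -> R) :
  H_recurrence mu H ->
  balanced <->
  (forall a b, (1 <= a)%N -> (1 <= b)%N ->
      gs a b = gs a 0%N
        + (mu b)^-1 * \sum_(1 <= k < b.+1) H a b k * gs k 0%N).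
Proof. by move=> hH; rewrite balancedP; exact: source_recurrenceP. Qed.

End Algebra.

(** * Sums over countable index sets *)

Section CountableSums.
Variables (R : realType) (I : countType).
Local Open Scope ereal_scope.
Implicit Types a : I -> \bar R.

Lemma oapp_ge0 a n : (forall i, 0 <= a i) -> 0 <= oapp a 0 (pickle_inv n).
Proof. by move=> a0; case: pickle_inv => /=. Qed.

(** Enumerating the index set turns [\esum] into a series, for which
    integration theorems are available. *)
Lemma esum_pickle a : (forall i, 0 <= a i) ->
  \esum_(i in [set: I]) a i = \sum_(n <oo) oapp a 0 (pickle_inv n).
Proof.
move=> a0; rewrite nneseries_esumT; last by move=> n; exact: oapp_ge0.
transitivity (\esum_(n in (@pickle I) @` setT) oapp a 0 (pickle_inv n)).
  rewrite (esum_image setT (@pickle I) (fun n => oapp a 0 (pickle_inv n))).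
    by apply: eq_esum => i _; rewrite pickleK_inv.
  by move=> x y _ _ /(pcan_inj (@pickleK I)).
rewrite esum_mkcond; apply: eq_esum => n _; case: ifPn => // /negP nn.
have := @pickle_invK I n; case: pickle_inv => //= i pi.
by case: nn; rewrite inE; exists i.
Qed.

Lemma esum_seq (s : seq I) a : uniq s -> (forall i, 0 <= a i) ->
  \esum_(i in [set: I]) (if i \in s then a i else 0) = \sum_(i <- s) a i.
Proof.
move=> us a0; rewrite fsbig_seq// -esum_fset//.
rewrite [RHS]esum_mkcond; apply: eq_esum => i _.
by congr (if _ then _ else _); apply/idP/idP; rewrite inE.
Qed.

Lemma esumZl (A : set I) (c : R) a : (0 <= c)%R -> (forall i, A i -> 0 <= a i) ->
  \esum_(i in A) (c%:E * a i) = c%:E * \esum_(i in A) a i.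
Proof.
move=> c0 a0; rewrite esum_mkcond [in RHS]esum_mkcond.
have b0 i : 0 <= (if i \in A then a i else 0).
  by case: ifPn => //; rewrite inE => /a0.
rewrite [in RHS]esum_pickle// -nneseriesZl; last first.
  by move=> n _; exact: oapp_ge0.
rewrite esum_pickle; last first.
  by move=> i; have := b0 i; case: ifPn => // _ ai; rewrite mule_ge0.
apply: eq_eseriesr => n _; case: pickle_inv => [i|]/=; last by rewrite mule0.
by case: ifPn => //; rewrite mule0.
Qed.

Lemma esum_pair (J : countType) (a : I -> J -> \bar R) :
  (forall i j, 0 <= a i j) ->
  \esum_(k in [set: I * J]) a k.1 k.2 =
  \esum_(i in [set: I]) \esum_(j in [set: J]) a i j.
Proof.
move=> a0; rewrite esum_esum//; congr esum.
by apply/seteqP; split.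
Qed.

Lemma esum_pair_swap (J : countType) (a : I -> J -> \bar R) :
  (forall i j, 0 <= a i j) ->
  \esum_(k in [set: I * J]) a k.1 k.2 =
  \esum_(j in [set: J]) \esum_(i in [set: I]) a i j.
Proof.
move=> a0; rewrite esum_esum//.
rewrite (_ : _ `*`` _ = setT); last exact/seteqP.
rewrite (reindex_esum setT setT (fun x : J * I => (x.2, x.1)))//; split=> //=.
  by move=> [i j] [i' j'] _ _ [-> ->].
by move=> [i j] _; exists (j, i).
Qed.

(** Dominated convergence for the counting measure, transported along the
    enumeration of the index set. *)
Lemma esum_dominated (u : nat -> I -> R) (l v : I -> R) :
  (forall n i, 0 <= u n i <= v i)%R ->
  (forall i, u n i @[n --> \oo] --> l i) ->
  \esum_(i in [set: I]) (v i)%:E < +oo ->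
  \esum_(i in [set: I]) (u n i)%:E @[n --> \oo] -->
  \esum_(i in [set: I]) (l i)%:E.
Proof.
move=> uv ul v_fin.
have u0 n i : (0 <= u n i)%R by case/andP: (uv n i).
have v0 i : (0 <= v i)%R by case/andP: (uv 0%N i) => /le_trans; exact.
have l0 i : (0 <= l i)%R.
  by apply: (cvgr_to_ge (ul i)); apply: nearW.
pose F (w : I -> R) (k : nat) : \bar R := oapp (EFin \o w) 0 (pickle_inv k).
have FE (w : I -> R) : (forall i, 0 <= w i)%R ->
    \esum_(i in [set: I]) (w i)%:E = \int[counting]_k F w k.
  by move=> w0; rewrite esum_pickle// ge0_integral_count// => k; exact: oapp_ge0.
rewrite (FE l)//.
under eq_fun do rewrite FE//.
have [] := @dominated_convergence _ _ _ (@counting _ R) setT measurableT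
  (fun n => F (u n)) (F l) (F v).
- by move=> n.
- by [].
- apply: aeW => k _; rewrite /F; case: pickle_inv => [i|]/=.
    by apply/fine_cvgP; split; [exact: nearW|exact: ul].
  exact: cvg_cst.
- apply/integrableP; split => //.
  under eq_integral => k _. rewrite gee0_abs; last exact: oapp_ge0. over.
    by rewrite -FE.
- apply: aeW => k n _; rewrite gee0_abs; last by apply: oapp_ge0 => i; rewrite /= lee_fin.
  by rewrite /F; case: pickle_inv => //= i; rewrite lee_fin; case/andP: (uv n i).
- by [].
Qed.

Section Tonelli.
Context d (T : measurableType d) (m : {measure set T -> \bar R}).
Variables (D : set T) (mD : measurable D).
Variable f : I -> (T -> \bar R).
Hypothesis mf : forall i, measurable_fun D (f i : T -> \bar R).
Hypothesis f0 : forall i x, 0 <= f i x.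

Lemma measurable_esum :
  measurable_fun D (fun x => \esum_(i in [set: I]) f i x).
Proof.
under eq_fun do rewrite esum_pickle//.
apply: (@ge0_emeasurable_sum _ _ _ _ _ xpredT).
  by move=> n x _ _; exact: oapp_ge0.
by move=> n _; case: pickle_inv => [i|]/=; [exact: mf|exact: measurable_cst].
Qed.

Lemma integral_esum :
  \int[m]_(x in D) (\esum_(i in [set: I]) f i x) =
  \esum_(i in [set: I]) \int[m]_(x in D) f i x.
Proof.
under eq_integral do rewrite esum_pickle//.
rewrite integral_nneseries//.
- rewrite esum_pickle; last by move=> i; exact: integral_ge0.
  apply: eq_eseriesr => n _; case: pickle_inv => [i|]//=.
  by rewrite integral0.
- by move=> n; case: pickle_inv => [i|]/=; [exact: mf|exact: measurable_cst].
- by move=> n x _; exact: oapp_ge0.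
Qed.

End Tonelli.
End CountableSums.

(** * Kernel sums over the pairs that meet a finite set *)

Section Kernel.
Variables (R : realType) (d : nat) (p : lattice d -> lattice d -> R).
Hypothesis p_prob : transition_probability p.
Hypothesis p_transl : translation_invariant_kernel p.

Lemma kernel_ge0 x y : 0 <= p x y.
Proof. exact: p_prob.1. Qed.

(** Translation by [y - x] exchanges the roles of the two arguments, so that
    column sums become row sums. *)
Lemma kernel_reflect x y : p x y = p y (y + y - x).
Proof.
have /= := p_transl x y (y - x).
by rewrite addrCA subrr addr0 addrA => <-.
Qed.

Lemma kernel_out x : (\esum_(y in [set: lattice d]) (p x y)%:E = 1)%E.
Proof. exact: p_prob.2. Qed.

Lemma kernel_in y : (\esum_(x in [set: lattice d]) (p x y)%:E = 1)%E.
Proof.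
rewrite -(kernel_out y) [RHS](reindex_esum setT setT (fun x => y + y - x))//.
  by apply: eq_esum => x _; rewrite kernel_reflect.
split=> //= [x x' _ _ e|x _].
  by apply: oppr_inj; apply: addrI e.
by exists (y + y - x) => //; rewrite opprB addrC subrK.
Qed.

(** The pairs whose jumps can change a function that depends on [s] only. *)
Definition touches (s : seq (lattice d)) (x y : lattice d) : bool :=
  (x != y) && ((x \in s) || (y \in s)).

Lemma escape (q : lattice d -> R) (s : seq (lattice d)) (c : R) :
  (forall y, 0 <= q y) -> (\esum_(y in [set: lattice d]) (q y)%:E = 1)%E ->
  uniq s -> 0 <= c ->
  (\esum_(y in [set: lattice d]) (if y \in s then 0 else (q y)%:E * c%:E)
    = ((1 - \sum_(y <- s) q y) * c)%:E)%E.
Proof.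
move=> q0 q1 us c0.
have h : ((\sum_(y <- s) q y)%:E +
   \esum_(y in [set: lattice d]) (if y \in s then 0 else (q y)%:E) = 1)%E.
  rewrite -sumEFin -(esum_seq (a := EFin \o q))//.
  rewrite -esumD; last 2 first.
  - by move=> y _; case: ifP => // _; rewrite lee_fin.
  - by move=> y _; case: ifP => // _; rewrite lee_fin.
  rewrite -q1; apply: eq_esum => y _.
  by case: ifP; rewrite ?adde0 ?add0e.
transitivity (\esum_(y in [set: lattice d])
    (c%:E * (if y \in s then 0 else (q y)%:E)))%E.
  by apply: eq_esum => y _; case: ifP; rewrite ?mule0// muleC.
rewrite esumZl//; last by move=> y _; case: ifP => // _; rewrite lee_fin.
rewrite mulrC EFinM; congr (_ * _)%E.
by rewrite EFinB -h addeAC subee// add0e.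
Qed.

(** If [F x y] depends only on the endpoint in [s] as soon as the other endpoint
    is outside [s], the sum over the infinitely many pairs that meet [s] is
    finite: a site of [s] exchanges with the outside at the total rate that is
    left over by its exchanges within [s]. *)
Lemma esum_touches (s : seq (lattice d)) (F : lattice d -> lattice d -> \bar R)
    (K : lattice d -> lattice d -> R) (A B : lattice d -> R) :
  uniq s ->
  (forall x y, 0 <= F x y)%E ->
  {in s &, forall x y, x != y -> F x y = (K x y)%:E} ->
  {in s, forall x, 0 <= A x /\ forall y, y \notin s -> F x y = (A x)%:E} ->
  {in s, forall y, 0 <= B y /\ forall x, x \notin s -> F x y = (B y)%:E} ->
  (\esum_(i in [set: lattice d * lattice d])
     (if touches s i.1 i.2 then (p i.1 i.2)%:E * F i.1 i.2 else 0) =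
   (\sum_(x <- s) \sum_(y <- s | x != y) p x y * K x y +
    \sum_(x <- s) (1 - \sum_(y <- s) p x y) * A x +
    \sum_(y <- s) (1 - \sum_(x <- s) p x y) * B y)%:E)%E.
Proof.
move=> us F0 FK FA FB.
pose t1 x y : \bar R := if (x \in s) && (y \in s) && (x != y)
  then ((p x y)%:E * F x y)%E else 0%E.
pose t2 x y : \bar R := if (x \in s) && (y \notin s)
  then ((p x y)%:E * F x y)%E else 0%E.
pose t3 x y : \bar R := if (x \notin s) && (y \in s)
  then ((p x y)%:E * F x y)%E else 0%E.
have pF0 x y : (0 <= (p x y)%:E * F x y)%E by rewrite mule_ge0// lee_fin kernel_ge0.
have t10 x y : (0 <= t1 x y)%E by rewrite /t1; case: ifP.
have t20 x y : (0 <= t2 x y)%E by rewrite /t2; case: ifP.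
have t30 x y : (0 <= t3 x y)%E by rewrite /t3; case: ifP.
transitivity (\esum_(i in [set: lattice d * lattice d])
     (t1 i.1 i.2 + t2 i.1 i.2 + t3 i.1 i.2))%E.
  apply: eq_esum => -[x y] _ /=; rewrite /touches /t1 /t2 /t3.
  have [->|xy] := eqVneq x y; case: (_ \in s) => /=; rewrite ?adde0//.
    by case: (y \in s); rewrite ?adde0 ?add0e.
  by case: (y \in s); rewrite ?adde0 ?add0e.
rewrite esumD; [|by move=> i _; rewrite adde_ge0|by []].
rewrite esumD//.
rewrite (esum_pair t10) (esum_pair t20) (esum_pair_swap t30) !EFinD.
have innerE (z : lattice d) (G : lattice d -> \bar R) (b : pred (lattice d)) :
    (forall y, 0 <= G y)%E ->
    (\esum_(y in [set: lattice d]) (if (y \in s) && b y then G y else 0) =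
     \sum_(y <- s | b y) G y)%E.
  move=> G0; rewrite big_mkcond/= -esum_seq//.
    by apply: eq_esum => y _; case: ifP; case: (y \in s) => //= ->.
  by move=> y; case: ifP.
congr (_ + _ + _)%E.
- rewrite -sumEFin.
  transitivity (\esum_(x in [set: lattice d]) (if x \in s then
     \sum_(y <- s | x != y) (p x y)%:E * F x y else 0))%E.
    apply: eq_esum => x _; case: ifPn => xs.
      rewrite -innerE//; apply: eq_esum => y _.
      by rewrite /t1 xs.
    by apply: esum1 => y _; rewrite /t1 (negPf xs).
  rewrite esum_seq//; last by move=> x; apply: sume_ge0.
  apply: eq_big_seq => x xs; rewrite -sumEFin.
  rewrite big_seq_cond [RHS]big_seq_cond.
  by apply: eq_bigr => y /andP[ys xy]; rewrite FK.
- rewrite -sumEFin.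
  transitivity (\esum_(x in [set: lattice d]) (if x \in s then
     ((1 - \sum_(y <- s) p x y) * `|A x|)%:E else 0))%E.
    apply: eq_esum => x _; case: ifPn => xs.
      have [A0 FxA] := FA x xs; rewrite ger0_norm//.
      rewrite -(escape (kernel_ge0 x) (kernel_out x))//.
      by apply: eq_esum => y _; rewrite /t2 xs/=; case: (boolP (y \in s)) => //= ys; rewrite FxA.
    by apply: esum1 => y _; rewrite /t2 (negPf xs).
  rewrite esum_seq//; last first.
    move=> x; rewrite -(escape (kernel_ge0 x) (kernel_out x))//.
    apply: esum_ge0 => y _; case: ifP => // _.
    by rewrite mule_ge0// lee_fin// kernel_ge0.
  by apply: eq_big_seq => x /FA[A0 _]; rewrite ger0_norm.
- rewrite -sumEFin.
  transitivity (\esum_(y in [set: lattice d]) (if y \in s then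
     ((1 - \sum_(x <- s) p x y) * `|B y|)%:E else 0))%E.
    apply: eq_esum => y _; case: ifPn => ys.
      have [B0 FxB] := FB y ys; rewrite ger0_norm//.
      rewrite -(escape (kernel_ge0 ^~ y) (kernel_in y))//.
      apply: eq_esum => x _; rewrite /t3 ys andbT; case: (boolP (x \in s)) => //= xs.
      by rewrite FxB.
    by apply: esum1 => x _; rewrite /t3 (negPf ys) andbF.
  rewrite esum_seq//; last first.
    move=> y; rewrite -(escape (kernel_ge0 ^~ y) (kernel_in y))//.
    apply: esum_ge0 => x _; case: ifP => // _.
    by rewrite mule_ge0// lee_fin// kernel_ge0.
  by apply: eq_big_seq => x /FB[B0 _]; rewrite ger0_norm.
Qed.

End Kernel.

(** * Cylinder functions under a product measure *)

Section Cylinders.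
Variables (d : nat).
Implicit Types (eta zeta : conf d) (x y z : lattice d) (s t : seq (lattice d)).

Definition update eta x n : conf d := fun z => if z == x then n else eta z.

Definition depends_on s (T : Type) (f : conf d -> T) : Prop :=
  forall eta zeta, {in s, eta =1 zeta} -> f eta = f zeta.

Definition cylinder_event s (xi : conf d) : set (confM d) :=
  [set eta : conf d | forall x, x \in s -> eta x = xi x].

Lemma update_same eta x n : update eta x n x = n.
Proof. by rewrite /update eqxx. Qed.

Lemma update_other eta x n z : z != x -> update eta x n z = eta z.
Proof. by rewrite /update => /negPf ->. Qed.

Lemma depends_on_sub s t T (f : conf d -> T) :
  {subset s <= t} -> depends_on s f -> depends_on t f.
Proof. by move=> st hf eta zeta e; apply: hf => x /st /e. Qed.

Lemma depends_on_update s T (f : conf d -> T) x n : depends_on s f ->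
  depends_on [seq z <- s | z != x] (fun eta => f (update eta x n)).
Proof.
move=> hf eta zeta e; apply: hf => z zs; rewrite /update; case: eqVneq => // zx.
by apply: e; rewrite mem_filter zx.
Qed.

Lemma update_id s T (f : conf d -> T) x n eta : depends_on s f -> x \notin s ->
  f (update eta x n) = f eta.
Proof.
move=> hf xs; apply: hf => z zs; rewrite update_other//.
by apply: contraNneq xs => <-.
Qed.

Lemma measurable_coordinate x n : measurable ([set eta : conf d | eta x = n] : set (confM d)).
Proof. by apply: sub_sigma_algebra; exists x, n. Qed.

Lemma measurable_cylinder_event s xi : measurable (cylinder_event s xi).
Proof.
elim: s => [|x s IH].
  rewrite (_ : cylinder_event _ _ = setT); first exact: measurableT.
  by apply/seteqP; split.
rewrite (_ : cylinder_event _ _ =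
    [set eta : conf d | eta x = xi x] `&` cylinder_event s xi).
  by apply: measurableI => //; exact: measurable_coordinate.
apply/seteqP; split=> [eta h|eta [h1 h2] z].
  by split=> [|z zs]; apply: h; rewrite inE ?eqxx ?zs ?orbT.
by rewrite inE => /predU1P[->//|]; exact: h2.
Qed.

(** The restrictions of configurations to [s] are countably many, so preimages
    are countable unions of cylinder events. *)
Lemma measurable_depends_on s d' (U : measurableType d') (f : conf d -> U) :
  depends_on s f -> measurable_fun [set: confM d] (f : confM d -> U).
Proof.
move=> hf _ B mB; rewrite setTI.
pose A k : set (confM d) := [set eta : conf d | pickle (map eta s) = k /\ B (f eta)].
rewrite (_ : f @^-1` B = \bigcup_k A k); last first.
  apply/seteqP; split=> [eta h|eta [k _ []]//].
  by exists (pickle (map eta s)).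
apply: bigcupT_measurable => k.
have [[eta0 [k0 B0]]|none] := pselect (A k !=set0); last first.
  rewrite (_ : A k = set0); first exact: measurable0.
  by apply/seteqP; split=> // eta h; case: none; exists eta.
rewrite (_ : A k = cylinder_event s eta0); first exact: measurable_cylinder_event.
apply/seteqP; split=> [eta [kE BE] x xs|eta h].
  move: kE; rewrite -k0 => /(pcan_inj pickleK) /eq_in_map; exact.
split; last by rewrite (hf eta eta0).
by rewrite -k0; congr pickle; apply/eq_in_map.
Qed.

End Cylinders.

Section ProductExpectation.
Variables (R : realType) (d : nat).
Variables (nu : probability (confM d) R) (mu : nat -> R).
Hypothesis nu_prod : product_measure nu.
Hypothesis nu_marg : site_marginal nu mu.
Hypothesis mu_gt0 : forall n, 0 < mu n.
Implicit Types (F f : conf d -> R) (s t : seq (lattice d)).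
Local Open Scope ereal_scope.

Let mu_ge0 n : (0 <= mu n)%R. Proof. exact: ltW. Qed.

Lemma cylinder_event_prob t xi : uniq t ->
  nu (cylinder_event t xi) = (\prod_(z <- t) mu (xi z))%:E.
Proof.
move=> ut; rewrite [LHS]nu_prod// -prodEFin.
by apply: eq_bigr => z _; rewrite nu_marg.
Qed.

Lemma integral_split_site (D : set (confM d)) x s F : measurable D ->
  (forall eta, 0 <= F eta)%R -> depends_on s F ->
  \int[nu]_(eta in D) (F eta)%:E =
  \sum_(n <oo) \int[nu]_(eta in D `&` [set eta : conf d | eta x = n]) (F eta)%:E.
Proof.
move=> mD F0 Fs.
rewrite -ge0_integral_bigcup.
- congr integral; rewrite -setI_bigcupr (_ : \bigcup_n _ = setT) ?setIT//.
  by apply/seteqP; split=> // eta _; exists (eta x).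
- by move=> n; apply: measurableI => //; exact: measurable_coordinate.
- apply/measurable_EFinP; apply: measurable_funTS; exact: measurable_depends_on Fs.
- by move=> eta _; rewrite lee_fin.
- move=> n m _ _ [eta [[_ /= <-] [_ /= <-]]]; exact.
Qed.

(** Independence of a cylinder event and a function of finitely many other
    sites. Splitting according to the occupation of a site [z] on which [F]
    depends moves [z] from the support of [F] to the cylinder event; when no
    site is left, [F] is constant. *)
Lemma integral_cylinder_event s F t xi : uniq s -> uniq t ->
  {in t, forall z, z \notin s} ->
  (forall eta, 0 <= F eta)%R -> depends_on s F ->
  \int[nu]_(eta in cylinder_event t xi) (F eta)%:E =
  (\prod_(z <- t) mu (xi z))%:E * \int[nu]_eta (F eta)%:E.
Proof.
elim: s F t xi => [|z s IH] F t xi /=.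
  move=> _ ut _ F0 Fs.
  have cstE (D : set (confM d)) : measurable D ->
      \int[nu]_(eta in D) (F eta)%:E = (F (fun=> 0%N))%:E * nu D.
    by move=> mD; rewrite -integral_cst//; apply: eq_integral => eta _;
       congr EFin; exact: Fs.
  rewrite !cstE//; last exact: measurable_cylinder_event.
  by rewrite cylinder_event_prob// probability_setT mule1 muleC.
move=> /andP[zs us] ut ts F0 Fs.
have zt : z \notin t.
  by apply/negP => /ts; rewrite inE eqxx.
have main t' xi' : uniq t' -> {in t', forall x, x \notin z :: s} ->
    \int[nu]_(eta in cylinder_event t' xi') (F eta)%:E =
    \sum_(n <oo) (\prod_(x <- t') mu (xi' x))%:E *
       ((mu n)%:E * \int[nu]_eta (F (update eta z n))%:E).
  move=> ut' t's; rewrite (integral_split_site z _ F0 Fs); last first.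
    exact: measurable_cylinder_event.
  have zt' : z \notin t' by apply/negP => /t's; rewrite inE eqxx.
  apply: eq_eseriesr => n _.
  transitivity (\int[nu]_(eta in cylinder_event (z :: t') (update xi' z n))
      (F (update eta z n))%:E).
    rewrite (_ : _ `&` _ = cylinder_event (z :: t') (update xi' z n)).
      apply: eq_integral => eta; rewrite inE => h.
      congr EFin; congr F; apply/funext => x; rewrite /update.
      case: eqVneq => // ->; rewrite (h z) ?inE ?eqxx//.
      by rewrite update_same.
    apply/seteqP; split=> [eta [h1 /= h2] x|eta h].
      rewrite inE => /predU1P[->|xt']; first by rewrite update_same.
      by rewrite update_other ?h1//; apply: contraNneq zt' => <-.
    split=> [x xt'|/=]; last by rewrite h ?inE ?eqxx// update_same.
    rewrite h ?inE ?xt' ?orbT// update_other//.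
    by apply: contraNneq zt' => <-.
  rewrite IH//.
  - rewrite big_cons update_same mulrC EFinM muleA; congr (_%:E * _ * _).
    apply: eq_big_seq => x xt'; rewrite update_other//.
    by apply: contraNneq zt' => <-.
  - by rewrite /= zt'.
  - move=> x; rewrite inE => /predU1P[->//|/t's].
    by rewrite inE negb_or => /andP[].
  - move=> eta zeta e; apply: Fs => x; rewrite inE /update.
    by case: eqVneq => //= _; exact: e.
rewrite main//.
have -> : \int[nu]_eta (F eta)%:E =
    \int[nu]_(eta in cylinder_event [::] xi) (F eta)%:E.
  by congr integral; apply/seteqP; split.
rewrite main// nneseriesZl; last first.
  by move=> n _; rewrite mule_ge0// ?lee_fin//; apply: integral_ge0 => *;
     rewrite lee_fin.
by congr (_ * _); apply: eq_eseriesr => n _; rewrite big_nil mul1e.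
Qed.

(** Fubini's theorem for a single site. *)
Lemma integral_site x s F : (forall eta, 0 <= F eta)%R -> depends_on s F ->
  \int[nu]_eta (F eta)%:E =
  \sum_(n <oo) (mu n)%:E * \int[nu]_eta (F (update eta x n))%:E.
Proof.
move=> F0 Fs; rewrite (integral_split_site x measurableT F0 Fs).
apply: eq_eseriesr => n _; rewrite setTI.
rewrite (_ : [set eta | _] = cylinder_event [:: x] (fun=> n)); last first.
  apply/seteqP; split=> eta h /=; last by apply: h; rewrite inE.
  by move=> z; rewrite inE => /eqP ->.
transitivity (\int[nu]_(eta in cylinder_event [:: x] (fun=> n))
    (F (update eta x n))%:E).
  apply: eq_integral => eta; rewrite inE => h.
  congr EFin; congr F; apply/funext => z; rewrite /update.
  by case: eqVneq => // ->; rewrite h ?inE.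
rewrite (@integral_cylinder_event (undup [seq z <- s | z != x])) ?undup_uniq//.
- by rewrite big_seq1.
- by move=> z; rewrite inE => /eqP ->; rewrite mem_undup mem_filter eqxx.
- apply: depends_on_sub (depends_on_update (x := x) n Fs) => z.
  by rewrite mem_undup.
Qed.

Lemma integral_two_sites x y s F : (forall eta, 0 <= F eta)%R -> depends_on s F ->
  \int[nu]_eta (F eta)%:E =
  \sum_(a <oo) \sum_(b <oo) (mu a * mu b)%:E *
     \int[nu]_eta (F (update (update eta y b) x a))%:E.
Proof.
move=> F0 Fs; rewrite (integral_site x F0 Fs); apply: eq_eseriesr => a _.
rewrite (@integral_site y _ (fun eta => F (update eta x a)) _
  (depends_on_update (x := x) a Fs))//.
rewrite -nneseriesZl; last first.
  by move=> n _; rewrite mule_ge0// ?lee_fin//; apply: integral_ge0 => *;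
     rewrite lee_fin.
by apply: eq_eseriesr => b _; rewrite EFinM muleA.
Qed.

Lemma nneseries_shift (k : nat) (u : nat -> \bar R) : (forall n, 0 <= u n) ->
  \sum_(n <oo) (if (k <= n)%N then u n else 0) = \sum_(n <oo) u (n + k)%N.
Proof.
move=> u0; rewrite nneseries_addn//.
by rewrite [RHS]eseries_cond [RHS]eseries_mkcond.

Qed.

(** The change of variables behind the adjoint of a jump: both sides are expanded
    over the occupations of [x] and [y], and the shift [(a, b)] to
    [(a + k, b - k)] maps one double series to the other. *)
Lemma integral_jump (k : nat) x y s (phi : nat -> nat -> R) f :
  x != y -> (forall a b, 0 <= phi a b)%R ->
  (forall eta, 0 <= f eta)%R -> depends_on s f ->
  \int[nu]_eta (if (k <= eta x)%N
     then phi (eta x) (eta y) * f (move k x y eta) else 0)%:E =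
  \int[nu]_eta (f eta * (if (k <= eta y)%N
     then phi (eta x + k)%N (eta y - k)%N *
       (mu (eta x + k)%N * mu (eta y - k)%N / (mu (eta x) * mu (eta y)))
     else 0))%:E.
Proof.
move=> xy phi0 f0 fs.
have yx : y != x by rewrite eq_sym.
have mup a b : (0 <= mu (a + k)%N * mu (b - k)%N / (mu a * mu b))%R.
  by rewrite divr_ge0// mulr_ge0.
rewrite (@integral_two_sites x y (x :: y :: s)); last 2 first.
- by move=> eta; case: ifP => // _; rewrite mulr_ge0.
- move=> eta zeta e; rewrite !(e x) ?(e y) ?inE ?eqxx ?orbT//.
  case: ifP => // _; congr (_ * _)%R; apply: fs => z zs.
  rewrite /move !(e x) ?(e y) ?inE ?eqxx ?orbT// xy; case: ifP => _.
    by rewrite e// !inE zs !orbT.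
  by rewrite e// !inE zs !orbT.
rewrite [RHS](@integral_two_sites x y (x :: y :: s)); last 2 first.
- by move=> eta; rewrite mulr_ge0//; case: ifP => // _; rewrite mulr_ge0.
- move=> eta zeta e; rewrite !(e x) ?(e y) ?inE ?eqxx ?orbT//.
  congr (_ * _)%R; apply: fs => z zs.
  by rewrite e// !inE zs !orbT.
pose c a b := \int[nu]_eta (f (update (update eta y b) x a))%:E.
have c0 a b : 0 <= c a b by apply: integral_ge0 => eta _; rewrite lee_fin.
have mf a b : measurable_fun [set: confM d]
    (fun eta : confM d => (f (update (update eta y b) x a))%:E).
  apply/measurable_EFinP.
  exact: measurable_depends_on (depends_on_update b (depends_on_update a fs)).
transitivity (\sum_(a <oo) if (k <= a)%N then \sum_(b <oo)
   (mu a * mu b * phi a b)%:E * c (a - k)%N (b + k)%N else 0).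
  apply: eq_eseriesr => a _; case: ifPn => ka; last first.
    apply: eseries0 => b _ _; rewrite integral0_eq ?mule0//= => eta _.
    by rewrite update_same (negPf ka).
  apply: eq_eseriesr => b _.
  rewrite [in RHS]EFinM -muleA; congr (_ * _).
  rewrite -ge0_integralZl//; last by rewrite lee_fin.
  - apply: eq_integral => eta _.
    rewrite update_same ka update_other// update_same -EFinM.
    congr (_ * f _)%:E; apply/funext => z; rewrite /move update_same ka xy/=.
    rewrite /update (negPf yx) eqxx; case: (eqVneq z x) => // zx.
    by case: (eqVneq z y).
  - by move=> eta _; rewrite lee_fin.
transitivity (\sum_(a <oo) \sum_(b <oo) if (k <= b)%N then
   (mu (a + k)%N * mu (b - k)%N * phi (a + k)%N (b - k)%N)%:E * c a b else 0);
   last first.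
  apply: eq_eseriesr => a _; apply: eq_eseriesr => b _.
  case: ifPn => kb; last first.
    rewrite integral0_eq ?mule0//= => eta _.
    by rewrite update_other// update_same (negPf kb) mulr0.
  rewrite /c -ge0_integralZl//; last by rewrite lee_fin !mulr_ge0.
    rewrite -ge0_integralZl//; last by rewrite lee_fin mulr_ge0.
    - apply: eq_integral => eta _.
      rewrite update_same update_other// update_same kb -!EFinM; congr EFin.
      field; rewrite !gt_eqF//.
    - apply/measurable_EFinP.
      apply: (@measurable_depends_on _ (s)) => eta zeta e.
      rewrite !update_same !(update_other _ _ yx) !update_same; congr (_ * _)%R.
      apply: fs => z zs; rewrite /update; case: ifP => // _.
      by case: ifP => // _; exact: e.
    - move=> eta _; rewrite lee_fin mulr_ge0//; case: ifP => // _.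
      by rewrite mulr_ge0.
  by move=> eta _; rewrite lee_fin.
rewrite (@nneseries_shift k (fun a => \sum_(b <oo)
   (mu a * mu b * phi a b)%:E * c (a - k)%N (b + k)%N)); last first.
  by move=> a; apply: nneseries_ge0 => b _ _; rewrite mule_ge0// lee_fin !mulr_ge0.
apply: eq_eseriesr => a _.
rewrite (@nneseries_shift k (fun b => (mu (a + k)%N * mu (b - k)%N *
    phi (a + k)%N (b - k)%N)%:E * c a b)); last first.
  by move=> b; rewrite mule_ge0// lee_fin !mulr_ge0.
by apply: eq_eseriesr => b _; rewrite !addnK.
Qed.

End ProductExpectation.

(** * Gain and loss of the generator *)

Lemma esum_range (R : realType) (h : nat -> R) b : (forall k, 0 <= h k) ->
  (\esum_(k in [set: nat]) (if (0 < k <= b)%N then h k else 0)%:E =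
   (\sum_(1 <= k < b.+1) h k)%:E)%E.
Proof.
move=> h0; rewrite -sumEFin -esum_seq ?iota_uniq//.
by apply: eq_esum => k _; rewrite mem_index_iota ltnS; case: ifP.
Qed.

Section MMTPGenerator.
Variables (R : realType) (d : nat) (p : lattice d -> lattice d -> R).
Hypothesis p_prob : transition_probability p.
Hypothesis p_transl : translation_invariant_kernel p.
Variables (nu : probability (confM d) R) (mu : nat -> R).
Hypothesis nu_prod : product_measure nu.
Hypothesis nu_marg : site_marginal nu mu.
Hypothesis mu_gt0 : forall n, 0 < mu n.
Variable gs : nat -> nat -> R.
Hypothesis gs_ge0 : forall k b, (0 < k)%N -> 0 <= gs k b.
Implicit Types (f : conf d -> R) (s t : seq (lattice d)) (x y : lattice d).

Let g := MMTP_rates gs.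

Let g_ge0 k a b : 0 <= g k a b.
Proof. by rewrite /g /MMTP_rates; case: ifP => // /andP[/gs_ge0]. Qed.

Lemma out_rate_ge0 a b : 0 <= out_rate gs a b.
Proof. by rewrite /out_rate big_nat sumr_ge0// => k /andP[/gs_ge0]. Qed.

Lemma in_rate_ge0 a b : 0 <= in_rate mu gs a b.
Proof.
rewrite /in_rate big_nat sumr_ge0// => k /andP[k0 _].
by rewrite mulr_ge0 ?gs_ge0// divr_ge0// mulr_ge0// ltW.
Qed.

Lemma depends_on_two f s x y (q : nat -> nat -> R) : depends_on s f ->
  depends_on (x :: y :: s) (fun eta => f eta * q (eta x) (eta y)).
Proof.
move=> fs eta zeta e; rewrite !(e x) ?(e y) ?inE ?eqxx ?orbT//.
by congr (_ * _); apply: fs => z zs; apply: e; rewrite !inE zs !orbT.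
Qed.

Lemma depends_on_jump f s x y (q : nat -> nat -> R) k : depends_on s f ->
  depends_on (x :: y :: s)
    (fun eta => q (eta x) (eta y) * f (move k x y eta)).
Proof.
move=> fs eta zeta e; rewrite !(e x) ?(e y) ?inE ?eqxx ?orbT//.
congr (_ * _); apply: fs => z zs.
rewrite /move !(e x) ?(e y) ?inE ?eqxx ?orbT//.
by case: ifP => _; rewrite e// !inE zs !orbT.
Qed.

Lemma esum_loss f s x y : (forall eta, 0 <= f eta) -> depends_on s f ->
  (\esum_(k in [set: nat]) \int[nu]_eta (g k (eta x) (eta y) * f eta)%:E =
   \int[nu]_eta (f eta * out_rate gs (eta x) (eta y))%:E)%E.
Proof.
move=> f0 fs; rewrite -integral_esum//.
- apply: eq_integral => eta _.
  transitivity (\esum_(k in [set: nat]) ((f eta)%:E *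
     (if (0 < k <= eta x)%N then `|gs k (eta y)| else 0)%:E))%E.
    apply: eq_esum => k _; rewrite mulrC EFinM; congr (_ * _%:E)%E.
    rewrite /g /MMTP_rates; case: ifP => // /andP[k0 _].
    by rewrite ger0_norm// gs_ge0.
  rewrite esumZl//; last by move=> k _; rewrite lee_fin; case: ifP.
  rewrite esum_range// -EFinM; congr (_ * _)%:E.
  by apply: eq_big_nat => k /andP[k0 _]; rewrite ger0_norm// gs_ge0.
- move=> k; apply/measurable_EFinP.
  apply: (@measurable_depends_on _ (x :: y :: s)).
  move=> eta zeta e; rewrite ![_ * f _]mulrC.
  exact: (@depends_on_two f s x y (g k) fs).
- by move=> k eta; rewrite lee_fin mulr_ge0.
Qed.

(** By [integral_jump], the jumps from [x] to [y] can be counted where they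
    arrive. *)
Lemma esum_gain f s x y : x != y -> (forall eta, 0 <= f eta) -> depends_on s f ->
  (\esum_(k in [set: nat])
      \int[nu]_eta (g k (eta x) (eta y) * f (move k x y eta))%:E =
   \int[nu]_eta (f eta * in_rate mu gs (eta x) (eta y))%:E)%E.
Proof.
move=> xy f0 fs.
pose h k a b := gs k (b - k)%N * (mu (a + k)%N * mu (b - k)%N / (mu a * mu b)).
pose h' k a b := if (0 < k <= b)%N then `|h k a b| else 0.
have h0 k a b : (0 < k)%N -> 0 <= h k a b.
  move=> k0; rewrite mulr_ge0 ?gs_ge0// divr_ge0// mulr_ge0// ltW//.
transitivity (\esum_(k in [set: nat])
   \int[nu]_eta (f eta * h' k (eta x) (eta y))%:E)%E.
  apply: eq_esum => k _.
  have [->|k0] := posnP k.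
    by rewrite !integral0_eq// => eta _; rewrite /g /MMTP_rates /h' ?mulr0 ?mul0r.
  have := @integral_jump _ _ _ _ nu_prod nu_marg mu_gt0 k x y s
    (fun _ b => gs k b) f xy (fun _ b => gs_ge0 b k0) f0 fs.
  rewrite (_ : (fun eta : conf d => _) =
    (fun eta => (g k (eta x) (eta y) * f (move k x y eta))%:E)); last first.
    apply/funext => eta; rewrite /g /MMTP_rates k0/=.
    by case: ifP => // _; rewrite mul0r.
  move=> ->; apply: eq_integral => eta _; rewrite /h' k0/=.
  by case: ifP => // _; rewrite ger0_norm// h0.
rewrite -integral_esum//.
- apply: eq_integral => eta _.
  under eq_esum do rewrite EFinM.
  rewrite esumZl//; last by move=> k _; rewrite lee_fin /h'; case: ifP.
  rewrite /h' (esum_range (h := fun k => `|h k (eta x) (eta y)|))//.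
  rewrite -EFinM; congr (_ * _)%:E.
  by apply: eq_big_nat => k /andP[k0 _]; rewrite ger0_norm// h0.
- move=> k; apply/measurable_EFinP.
  apply: (@measurable_depends_on _ (x :: y :: s)).
  exact: (@depends_on_two f s x y (h' k) fs).
- by move=> k eta; rewrite lee_fin mulr_ge0// /h'; case: ifP.
Qed.

Definition touching_sum s (F : lattice d -> lattice d -> \bar R) : \bar R :=
  \esum_(i in [set: lattice d * lattice d])
    (if touches s i.1 i.2 then (p i.1 i.2)%:E * F i.1 i.2 else 0)%E.

Definition expected_flow f (q : nat -> nat -> R) x y : \bar R :=
  (\int[nu]_eta (f eta * q (eta x) (eta y))%:E)%E.

(** The generator is defined with [fine], which returns zero on an infinite
    value. This only matters on a negligible set. *)
Lemma integral_fine_sub (P N : confM d -> \bar R) :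
  measurable_fun setT P -> measurable_fun setT N ->
  (forall eta, 0 <= P eta)%E -> (forall eta, 0 <= N eta)%E ->
  (\int[nu]_eta P eta < +oo)%E -> (\int[nu]_eta N eta < +oo)%E ->
  nu.-integrable setT (fun eta => (fine (P eta - N eta))%:E) /\
  (\int[nu]_eta (fine (P eta - N eta))%:E
     = \int[nu]_eta P eta - \int[nu]_eta N eta)%E.
Proof.
move=> mP mN P0 N0 Pfin Nfin.
have iP : nu.-integrable setT P.
  apply/integrableP; split=> //.
  by under eq_integral do rewrite gee0_abs//.
have iN : nu.-integrable setT N.
  apply/integrableP; split=> //.
  by under eq_integral do rewrite gee0_abs//.
have mPN : measurable_fun setT (fun eta => (P eta - N eta)%E).
  exact: emeasurable_funB.
have mF : measurable_fun setT (fun eta => (fine (P eta - N eta))%:E).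
  by apply/measurable_EFinP; apply: measurableT_comp.
split.
  apply: le_integrable (integrableD measurableT iP iN) => // eta _ /=.
  have := P0 eta; have := N0 eta; case: (P eta) => [a| |]; case: (N eta) => [b| |]//=.
  - rewrite !lee_fin => b0 a0; rewrite (ger0_norm (addr_ge0 a0 b0)).
    by rewrite (le_trans (ler_normB _ _))// !ger0_norm.
  - by move=> _ _; rewrite leey.
  - by move=> _ _; rewrite leey.
  - by move=> _ _; rewrite leey.
rewrite -integralB//; apply: ae_eq_integral => //.
have := integrable_ae measurableT iP; have := integrable_ae measurableT iN.
apply: filterS2 => eta /= /(_ I) Nf /(_ I) Pf _.
by rewrite fineK// fin_numB Nf Pf.
Qed.

(** The positive and negative parts [u+] and [u-] of the summands of the
    generator are not the gain and loss terms, but [u+ + loss = u- + gain]. For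
    nonnegative families this identity can be summed and integrated term by
    term, and finiteness of gain and loss allows subtraction at the end. Jumps
    between sites outside [s] are removed first, as each of gain and loss
    would be infinite with them. *)
Lemma generator_gain_loss f s :
  (forall eta, 0 <= f eta) -> depends_on s f ->
  let gain := touching_sum s (expected_flow f (in_rate mu gs)) in
  let loss := touching_sum s (expected_flow f (out_rate gs)) in
  (gain < +oo)%E -> (loss < +oo)%E ->
  nu.-integrable setT (EFin \o (generator p g f : confM d -> R)) /\
  (\int[nu]_eta (generator p g f eta)%:E = gain - loss)%E.
Proof.
move=> f0 fs gain loss gain_fin loss_fin.
pose u (i : lattice d * lattice d) (k : nat) (eta : conf d) : R :=
  p i.1 i.2 * g k (eta i.1) (eta i.2) * (f (move k i.1 i.2 eta) - f eta).
pose gn (i : lattice d * lattice d) (k : nat) (eta : conf d) : R :=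
  if touches s i.1 i.2 then
    p i.1 i.2 * (g k (eta i.1) (eta i.2) * f (move k i.1 i.2 eta)) else 0.
pose ls (i : lattice d * lattice d) (k : nat) (eta : conf d) : R :=
  if touches s i.1 i.2 then
    p i.1 i.2 * (g k (eta i.1) (eta i.2) * f eta) else 0.
have uE i k eta : u i k eta = gn i k eta - ls i k eta.
  rewrite /u /gn /ls; case: ifPn => [_|]; first by ring.
  rewrite negb_and negbK negb_or => /orP[xy|/andP[xs ys]].
    by rewrite /move xy andbF subrr mulr0 subr0.
  rewrite (_ : f (move k i.1 i.2 eta) = f eta) ?subrr ?mulr0//.
  apply: fs => z zs; rewrite /move; case: ifP => // _.
  by rewrite !ifN//; [apply: contraNneq ys|apply: contraNneq xs] => <-.
have pg0 i k eta h : 0 <= h -> 0 <= p i.1 i.2 * (g k (eta i.1) (eta i.2) * h).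
  by move=> h0; rewrite mulr_ge0 ?(kernel_ge0 p_prob)// mulr_ge0.
have gn0 i k eta : 0 <= gn i k eta by rewrite /gn; case: ifP => // _; exact: pg0.
have ls0 i k eta : 0 <= ls i k eta by rewrite /ls; case: ifP => // _; exact: pg0.
have mgn i k : measurable_fun [set: confM d] (gn i k : confM d -> R).
  apply: (@measurable_depends_on _ (i.1 :: i.2 :: s)) => eta zeta e.
  rewrite /gn; case: ifP => // _; congr (_ * _).
  exact: (@depends_on_jump f s i.1 i.2 (g k) k fs).
have mls i k : measurable_fun [set: confM d] (ls i k : confM d -> R).
  apply: (@measurable_depends_on _ (i.1 :: i.2 :: s)) => eta zeta e.
  rewrite /ls; case: ifP => // _; congr (_ * _); rewrite ![g _ _ _ * _]mulrC.
  exact: (@depends_on_two f s i.1 i.2 (g k) fs).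
pose tot (v : lattice d * lattice d -> nat -> conf d -> R) (eta : confM d) : \bar R :=
  \esum_(i in [set: lattice d * lattice d * nat]) (v i.1 i.2 eta)%:E.
pose pos i k eta := Num.max (u i k eta) 0.
pose neg i k eta := Num.max (- u i k eta) 0.
have mpos i k : measurable_fun [set: confM d] (pos i k : confM d -> R).
  rewrite (_ : pos i k = (fun eta => Num.max (gn i k eta - ls i k eta) 0));
    last by apply/funext => eta; rewrite /pos uE.
  by apply: measurable_maxr => //; exact: measurable_funB.
have mneg i k : measurable_fun [set: confM d] (neg i k : confM d -> R).
  rewrite (_ : neg i k = (fun eta => Num.max (ls i k eta - gn i k eta) 0));
    last by apply/funext => eta; rewrite /neg uE opprB.
  by apply: measurable_maxr => //; exact: measurable_funB.
have pos0 i k eta : 0 <= pos i k eta by rewrite le_max lexx orbT.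
have neg0 i k eta : 0 <= neg i k eta by rewrite le_max lexx orbT.
have genE : generator p g f = fun eta => fine (tot pos eta - tot neg eta).
  apply/funext => eta; rewrite /generator /rsum /tot; congr (fine (_ - _)).
    rewrite esum_mkcond; apply: eq_esum => -[[x y] k] _ /=.
    case: ifPn => //; rewrite notin_setE/= => /negP; rewrite -eqn0Ngt => /eqP ->.
    by rewrite /pos /u /= /g /MMTP_rates/= mulr0 mul0r maxxx.
  rewrite esum_mkcond; apply: eq_esum => -[[x y] k] _ /=.
  case: ifPn => //; rewrite notin_setE/= => /negP; rewrite -eqn0Ngt => /eqP ->.
  by rewrite /neg /u /= /g /MMTP_rates/= mulr0 mul0r oppr0 maxxx.
have mtot v : (forall i k, measurable_fun [set: confM d] (v i k : confM d -> R)) ->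
    (forall i k eta, 0 <= v i k eta) -> measurable_fun setT (tot v).
  move=> mv v0; apply: measurable_esum => [i|i eta]; last by rewrite lee_fin.
  exact/measurable_EFinP.
have itot v : (forall i k, measurable_fun [set: confM d] (v i k : confM d -> R)) ->
    (forall i k eta, 0 <= v i k eta) ->
    (\int[nu]_eta tot v eta = \esum_(i in [set: lattice d * lattice d])
      \esum_(k in [set: nat]) \int[nu]_eta (v i k eta)%:E)%E.
  move=> mv v0; rewrite integral_esum//.
  - rewrite (esum_pair (a := fun i k => (\int[nu]_eta (v i k eta)%:E)%E))// => i k.
    by apply: integral_ge0 => eta _; rewrite lee_fin.
  - by move=> i; exact/measurable_EFinP.
  - by move=> i eta; rewrite lee_fin.
have pullp (i : lattice d * lattice d) (h : conf d -> R) t : (forall eta, 0 <= h eta) ->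
    depends_on t h ->
    (\int[nu]_eta (p i.1 i.2 * h eta)%:E = (p i.1 i.2)%:E * \int[nu]_eta (h eta)%:E)%E.
  move=> h0 ht; rewrite -ge0_integralZl//; last by rewrite lee_fin (kernel_ge0 p_prob).
    by apply/measurable_EFinP; exact: measurable_depends_on ht.
  by move=> eta _; rewrite lee_fin.
have gainE : (\int[nu]_eta tot gn eta)%E = gain.
  rewrite itot//; apply: eq_esum => -[x y] _ /=; rewrite /gn/=.
  case: ifPn => [xys|_]; last by apply: esum1 => k _; rewrite integral0.
  rewrite /expected_flow -(esum_gain _ f0 fs); last by case/andP: xys.
  rewrite -esumZl ?(kernel_ge0 p_prob)//; last first.
    by move=> k _; apply: integral_ge0 => eta _; rewrite lee_fin mulr_ge0.
  apply: eq_esum => k _.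
  rewrite (pullp (x, y) _ _ _ (@depends_on_jump f s x y (g k) k fs))// => eta.
  by rewrite mulr_ge0.
have lossE : (\int[nu]_eta tot ls eta)%E = loss.
  rewrite itot//; apply: eq_esum => -[x y] _ /=; rewrite /ls/=.
  case: ifPn => [xys|_]; last by apply: esum1 => k _; rewrite integral0.
  rewrite /expected_flow -(esum_loss _ _ f0 fs).
  rewrite -esumZl ?(kernel_ge0 p_prob)//; last first.
    by move=> k _; apply: integral_ge0 => eta _; rewrite lee_fin mulr_ge0.
  apply: eq_esum => k _.
  under eq_integral do rewrite [X in _ * X]mulrC.
  rewrite (pullp (x, y) _ _ _ (@depends_on_two f s x y (g k) fs))//; last first.
    by move=> eta; rewrite mulr_ge0.
  by under eq_integral do rewrite [X in X%:E]mulrC.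
have itot_le v v' : (forall i k, measurable_fun [set: confM d] (v i k : confM d -> R)) ->
    (forall i k, measurable_fun [set: confM d] (v' i k : confM d -> R)) ->
    (forall i k eta, 0 <= v i k eta) -> (forall i k eta, 0 <= v' i k eta) ->
    (forall i k eta, v i k eta <= v' i k eta) ->
    (\int[nu]_eta tot v eta <= \int[nu]_eta tot v' eta)%E.
  move=> mv mv' v0 v'0 vv'; apply: ge0_le_integral => //.
  - by move=> eta _; apply: esum_ge0 => i _; rewrite lee_fin.
  - exact: mtot.
  - exact: mtot.
  - by move=> eta _; apply: le_esum => i _; rewrite lee_fin.
have pos_fin : (\int[nu]_eta tot pos eta < +oo)%E.
  apply: le_lt_trans gain_fin; rewrite -gainE; apply: itot_le => // i k eta.
  by rewrite /pos uE ge_max gn0 andbT gerBl.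
have neg_fin : (\int[nu]_eta tot neg eta < +oo)%E.
  apply: le_lt_trans loss_fin; rewrite -lossE; apply: itot_le => // i k eta.
  by rewrite /neg uE ge_max ls0 andbT opprB gerBl.
have tot0 v eta : (forall i k eta, 0 <= v i k eta) -> (0 <= tot v eta)%E.
  by move=> v0; apply: esum_ge0 => i _; rewrite lee_fin.
rewrite genE; have [int_gen ->] := integral_fine_sub (mtot _ mpos pos0) (mtot _ mneg neg0)
  (fun eta => tot0 _ eta pos0) (fun eta => tot0 _ eta neg0) pos_fin neg_fin.
split=> //.
(* Pointwise, [max u 0 + loss = max (- u) 0 + gain] as [u = gain - loss]. *)
have balance : (\int[nu]_eta tot pos eta + loss = \int[nu]_eta tot neg eta + gain)%E.
  rewrite -gainE -lossE -!ge0_integralD//; try by [exact: mtot|move=> *; exact: tot0].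
  apply: eq_integral => eta _; rewrite /tot -!esumD;
    try by [move=> i _; rewrite lee_fin].
  apply: eq_esum => -[i k] _; rewrite -!EFinD; congr EFin.
  rewrite /pos /neg uE/=; move: (gn i k eta) (ls i k eta) => a b.
  rewrite /Num.max; case: (ltP (a - b) 0) => h1;
    case: (ltP (- (a - b)) 0) => h2; lra.
have itot0 v : (forall i k eta, 0 <= v i k eta) ->
    (0 <= \int[nu]_eta tot v eta)%E.
  by move=> v0; apply: integral_ge0 => eta _; exact: tot0.
move: balance pos_fin neg_fin gain_fin loss_fin (itot0 _ pos0) (itot0 _ neg0).
have := itot0 _ gn0; have := itot0 _ ls0; rewrite gainE lossE.
case: (integral _ _ (tot pos)) (integral _ _ (tot neg)) gain loss {gainE lossE}
  => [P| |] [N| |] [G| |] [L| |]//.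
by rewrite -!EFinD => _ _ [e] _ _ _ _ _ _; congr EFin; lra.
Qed.

End MMTPGenerator.

(** * Zero expectation of the generator and balance of the rates *)

Section Balance.
Variables (R : realType) (d : nat) (p : lattice d -> lattice d -> R).
Hypothesis p_prob : transition_probability p.
Hypothesis p_transl : translation_invariant_kernel p.
Variables (nu : probability (confM d) R) (mu : nat -> R).
Hypothesis nu_prod : product_measure nu.
Hypothesis nu_marg : site_marginal nu mu.
Hypothesis mu_gt0 : forall n, 0 < mu n.
Variable gs : nat -> nat -> R.
Hypothesis gs_ge0 : forall k b, (0 < k)%N -> 0 <= gs k b.
Variable w : nat -> R.
Hypothesis w_ge0 : forall n, 0 <= w n.
Hypothesis out_le : forall a b, out_rate gs a b <= w a + w b.
Hypothesis w_fin : (\sum_(n <oo) (mu n * w n)%:E < +oo)%E.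
Implicit Types (f : conf d -> R) (s t : seq (lattice d)) (x y : lattice d).

Let g := MMTP_rates gs.
Let flow := expected_flow nu.

Lemma expected_coordinate (q : nat -> R) x : (forall n, 0 <= q n) ->
  (\int[nu]_eta (q (eta x))%:E = \sum_(n <oo) (mu n * q n)%:E)%E.
Proof.
move=> q0.
rewrite (@integral_site _ _ _ _ nu_prod nu_marg mu_gt0 x [:: x] (fun eta => q (eta x)))//.
  apply: eq_eseriesr => n _.
  under eq_integral do rewrite update_same.
  by rewrite integral_cst// [X in (_ * (_ * X))%E]probability_setT mule1 EFinM.
by move=> eta zeta e; rewrite e ?inE.
Qed.

Lemma measurable_coordinate_fun (q : nat -> R) x :
  measurable_fun [set: confM d] (fun eta : confM d => (q (eta x))%:E).
Proof.
apply/measurable_EFinP; apply: (@measurable_depends_on _ [:: x]).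
by move=> eta zeta e; rewrite e ?inE.
Qed.

Lemma measurable_flow f s x y (q : nat -> nat -> R) : depends_on s f ->
  measurable_fun [set: confM d]
    (fun eta : confM d => (f eta * q (eta x) (eta y))%:E).
Proof.
move=> fs; apply/measurable_EFinP.
exact: (measurable_depends_on (@depends_on_two _ _ f s x y q fs)).
Qed.

Lemma flow_ge0 f q x y : (forall eta, 0 <= f eta) -> (forall a b, 0 <= q a b) ->
  (0 <= flow f q x y)%E.
Proof.
by move=> f0 q0; apply: integral_ge0 => eta _; rewrite lee_fin mulr_ge0.
Qed.

Definition flow_bound (B : R) : R :=
  2 * (B * fine (\sum_(n <oo) (mu n * w n)%:E)%E).

Lemma flow_out_le f s B x y : (forall eta, 0 <= f eta <= B) -> depends_on s f ->
  (flow f (out_rate gs) x y <= (flow_bound B)%:E)%E.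
Proof.
move=> fB fs.
have B0 : 0 <= B by case/andP: (fB (fun=> 0%N)) => /le_trans; exact.
apply: (@le_trans _ _ (\int[nu]_eta ((B * w (eta x))%:E + (B * w (eta y))%:E))%E).
  apply: ge0_le_integral => //.
  - move=> eta _; have /andP[f0 _] := fB eta.
    by rewrite lee_fin mulr_ge0// out_rate_ge0.
  - exact: measurable_flow fs.
  - apply: emeasurable_funD; apply: measurable_coordinate_fun (fun n => B * w n) _.
  - move=> eta _; have /andP[f0 fBe] := fB eta.
    by rewrite -EFinD lee_fin -mulrDr ler_pM// out_rate_ge0.
rewrite ge0_integralD//; first last.
- exact: (measurable_coordinate_fun (fun n => B * w n)).
- by move=> eta _; rewrite lee_fin mulr_ge0.
- exact: (measurable_coordinate_fun (fun n => B * w n)).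
- by move=> eta _; rewrite lee_fin mulr_ge0.
have Bw n : 0 <= B * w n by rewrite mulr_ge0.
rewrite !(expected_coordinate _ Bw).
have -> : (\sum_(n <oo) (mu n * (B * w n))%:E =
           B%:E * \sum_(n <oo) (mu n * w n)%:E)%E.
  rewrite -nneseriesZl; last by move=> n _; rewrite lee_fin mulr_ge0// ltW.
  by apply: eq_eseriesr => n _; rewrite -EFinM mulrCA.
rewrite /flow_bound EFinM EFinM fineK; last first.
  rewrite ge0_fin_numE//; apply: nneseries_ge0 => n _ _.
  by rewrite lee_fin mulr_ge0// ltW.
by rewrite mule_natl mule2n.
Qed.

(** The gain is not bounded pointwise. Bounding [f] by the constant [B] first,
    its expectation becomes a loss, because [esum_gain] and [esum_loss] agree
    for constant functions. *)
Lemma flow_in_le f s B x y : x != y -> (forall eta, 0 <= f eta <= B) ->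
  depends_on s f -> (flow f (in_rate mu gs) x y <= (flow_bound B)%:E)%E.
Proof.
move=> xy fB fs.
have B0 : 0 <= B by case/andP: (fB (fun=> 0%N)) => /le_trans; exact.
have cs' : depends_on [::] ((fun=> B) : conf d -> R) by [].
apply: (@le_trans _ _ (flow (fun=> B) (in_rate mu gs) x y)).
  apply: ge0_le_integral => //.
  - move=> eta _; have /andP[f0 _] := fB eta.
    by rewrite lee_fin mulr_ge0// in_rate_ge0.
  - exact: measurable_flow fs.
  - exact: measurable_flow cs'.
  - move=> eta _; have /andP[f0 fBe] := fB eta.
    by rewrite lee_fin ler_wpM2r// in_rate_ge0.
rewrite /flow /expected_flow -(esum_gain nu_prod nu_marg mu_gt0 gs_ge0 xy _ cs')//.
rewrite (esum_loss nu gs_ge0 x y _ cs')//.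
by apply: flow_out_le cs' => eta; rewrite B0 lexx.
Qed.

Lemma touching_sum_fin s F (C : R) : uniq s -> 0 <= C ->
  (forall x y, x != y -> 0 <= F x y <= C%:E)%E ->
  (touching_sum p s F < +oo)%E.
Proof.
move=> us C0 FC.
have h := @esum_touches _ _ _ p_prob p_transl s (fun _ _ => C%:E)
   (fun _ _ => C) (fun _ => C) (fun _ => C) us.
apply: (@le_lt_trans _ _ (touching_sum p s (fun _ _ => C%:E))).
  apply: le_esum => -[x y] _ /=; case: ifP => // /andP[xy _].
  have /andP[_ FxC] := FC x y xy.
  by apply: lee_wpmul2l => //; rewrite lee_fin (kernel_ge0 p_prob).
by rewrite /touching_sum h// ltry.
Qed.

Lemma generator_expectation f s B : uniq s ->
  (forall eta, 0 <= f eta <= B) -> depends_on s f ->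
  let gain := touching_sum p s (flow f (in_rate mu gs)) in
  let loss := touching_sum p s (flow f (out_rate gs)) in
  [/\ (gain < +oo)%E, (loss < +oo)%E,
  nu.-integrable setT (EFin \o (generator p g f : confM d -> R)) &
  (\int[nu]_eta (generator p g f eta)%:E = gain - loss)%E].
Proof.
move=> us fB fs gain loss.
have f0 eta : 0 <= f eta by case/andP: (fB eta).
have B0 : 0 <= B by case/andP: (fB (fun=> 0%N)) => /le_trans; exact.
have C0 : 0 <= flow_bound B.
  rewrite !mulr_ge0// fine_ge0//; apply: nneseries_ge0 => n _ _.
  by rewrite lee_fin mulr_ge0// ltW.
have gfin : (gain < +oo)%E.
  apply: touching_sum_fin us C0 _ => x y xy.
  by rewrite (flow_in_le xy fB fs) flow_ge0// => a b; exact: in_rate_ge0.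
have lfin : (loss < +oo)%E.
  apply: touching_sum_fin us C0 _ => x y xy.
  by rewrite (flow_out_le x y fB fs) flow_ge0// => a b; exact: out_rate_ge0.
by have [] := generator_gain_loss p_prob nu_prod nu_marg mu_gt0 gs_ge0 f0 fs gfin lfin.
Qed.

Section Necessity.
Variables (t : seq (lattice d)) (xi : conf d).
Hypothesis ut : uniq t.

Let weight : R := \prod_(z <- t) mu (xi z).

Lemma depends_on_cylinder :
  depends_on t (\1_(cylinder_event t xi) : conf d -> R).
Proof.
move=> eta zeta e; rewrite !indicE; congr (_%:R); congr nat_of_bool.
apply/idP/idP; rewrite !inE => h z zt; first by rewrite -e// h.
by rewrite e// h.
Qed.

Lemma flow_cylinder (q : nat -> nat -> R) x y (h : conf d -> R) :
  (forall eta, cylinder_event t xi eta -> q (eta x) (eta y) = h eta) ->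
  flow \1_(cylinder_event t xi) q x y =
  (\int[nu]_(eta in cylinder_event t xi) (h eta)%:E)%E.
Proof.
move=> qh; rewrite [RHS]integral_mkcond; apply: eq_integral => eta _.
rewrite /patch indicE; case: ifPn; first by rewrite inE => /qh ->; rewrite mul1r.
by rewrite mul0r.
Qed.

Lemma flow_cylinder_in (q : nat -> nat -> R) x y : x \in t -> y \in t ->
  flow \1_(cylinder_event t xi) q x y = (weight * q (xi x) (xi y))%:E.
Proof.
move=> xt yt.
rewrite (@flow_cylinder _ _ _ (fun=> q (xi x) (xi y))); last first.
  by move=> eta h; rewrite !h.
rewrite integral_cst; last exact: measurable_cylinder_event.
by rewrite [X in (_ * X)%E](cylinder_event_prob nu_prod nu_marg)// mulrC.
Qed.

Lemma flow_cylinder_out (q : nat -> nat -> R) x y : (forall a b, 0 <= q a b) ->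
  x \in t -> y \notin t ->
  flow \1_(cylinder_event t xi) q x y =
    (weight%:E * \sum_(b <oo) (mu b * q (xi x) b)%:E)%E.
Proof.
move=> q0 xt yt.
rewrite (@flow_cylinder _ _ _ (fun eta => q (xi x) (eta y))); last first.
  by move=> eta h; rewrite h.
rewrite (@integral_cylinder_event _ _ _ _ nu_prod nu_marg mu_gt0 [:: y])//.
- by rewrite (expected_coordinate (q := q (xi x))).
- by move=> z zt; rewrite inE; apply: contraNneq yt => <-.
- by move=> eta zeta e; rewrite e ?inE.
Qed.

Lemma flow_cylinder_into (q : nat -> nat -> R) x y : (forall a b, 0 <= q a b) ->
  x \notin t -> y \in t ->
  flow \1_(cylinder_event t xi) q x y =
    (weight%:E * \sum_(a <oo) (mu a * q a (xi y))%:E)%E.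
Proof.
move=> q0 xt yt.
rewrite (@flow_cylinder _ _ _ (fun eta => q (eta x) (xi y))); last first.
  by move=> eta /(_ y yt) ->.
rewrite (@integral_cylinder_event _ _ _ _ nu_prod nu_marg mu_gt0 [:: x])//.
- by rewrite (expected_coordinate (q := q ^~ (xi y))).
- by move=> z zt; rewrite inE; apply: contraNneq xt => <-.
- by move=> eta zeta e; rewrite e ?inE.
Qed.

Definition mean_to (q : nat -> nat -> R) a : R :=
  fine (\sum_(b <oo) (mu b * q a b)%:E)%E.

Definition mean_from (q : nat -> nat -> R) b : R :=
  fine (\sum_(a <oo) (mu a * q a b)%:E)%E.

(** The value of [touching_sum] on the flow of a cylinder indicator, divided by
    the probability of the event: exchanges within [t] see the prescribed
    occupations, exchanges with the outside see an average over [mu]. *)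
Definition cylinder_flow (q : nat -> nat -> R) : R :=
  \sum_(x <- t) \sum_(y <- t | x != y) p x y * q (xi x) (xi y) +
  \sum_(x <- t) (1 - \sum_(y <- t) p x y) * mean_to q (xi x) +
  \sum_(y <- t) (1 - \sum_(x <- t) p x y) * mean_from q (xi y).

Lemma touching_sum_cylinder (q : nat -> nat -> R) :
  (forall a b, 0 <= q a b) ->
  (forall x y, x != y -> flow \1_(cylinder_event t xi) q x y < +oo)%E ->
  touching_sum p t (flow \1_(cylinder_event t xi) q) =
    (weight * cylinder_flow q)%:E.
Proof.
move=> q0 qfin.
have w0 : 0 < weight by exact: prodr_gt0.
have ind0 (eta : conf d) : 0 <= \1_(cylinder_event t xi) eta :> R by rewrite indicE.
have S0 (v : nat -> R) : (forall n, 0 <= v n) ->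
    (0 <= \sum_(n <oo) (mu n * v n)%:E)%E.
  by move=> v0; apply: nneseries_ge0 => n _ _; rewrite lee_fin mulr_ge0// ltW.
have finS (S : \bar R) : (0 <= S)%E -> (weight%:E * S < +oo)%E ->
    (weight%:E * S = (weight * fine S)%:E)%E.
  by case: S => [r| |]//= _; rewrite gt0_muley ?lte_fin// ltxx.
rewrite /touching_sum (@esum_touches _ _ _ p_prob p_transl t _
  (fun x y => weight * q (xi x) (xi y)) (fun x => weight * mean_to q (xi x))
  (fun y => weight * mean_from q (xi y)))//.
- congr EFin; rewrite /cylinder_flow !mulrDr !big_distrr/=; congr (_ + _ + _).
  + apply: eq_bigr => x _; rewrite big_distrr/=; apply: eq_bigr => y _; ring.
  + by apply: eq_bigr => x _; ring.
  + by apply: eq_bigr => x _; ring.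
- by move=> x y; exact: flow_ge0.
- by move=> x y xt yt _; exact: flow_cylinder_in.
- move=> x xt; split.
    by rewrite mulr_ge0// ?fine_ge0//; [exact: ltW|exact: S0].
  move=> y yt; have xy : x != y by apply: contraNneq yt => <-.
  move: (qfin x y xy); rewrite flow_cylinder_out// => /finS -> //.
  exact: S0.
- move=> y yt; split.
    by rewrite mulr_ge0// ?fine_ge0//; [exact: ltW|exact: (S0 (q ^~ _))].
  move=> x xt; have xy : x != y by apply: contraNneq xt => ->.
  move: (qfin x y xy); rewrite flow_cylinder_into// => /finS -> //.
  exact: (S0 (q ^~ _)).
Qed.

Lemma cylinder_flow_balance :
  (\int[nu]_eta (generator p g (\1_(cylinder_event t xi)) eta)%:E = 0)%E ->
  cylinder_flow (in_rate mu gs) = cylinder_flow (out_rate gs).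
Proof.
have fB eta : 0 <= (\1_(cylinder_event t xi) : conf d -> R) eta <= 1.
  by rewrite indicE; case: (_ \in _); rewrite ?lexx ler01.
have fs := depends_on_cylinder.
have [_ _ _ ->] := generator_expectation ut fB fs.
rewrite !touching_sum_cylinder.
- rewrite -EFinB -mulrBr => -[/eqP].
  rewrite mulf_eq0 subr_eq0 gt_eqF/=; first by move/eqP.
  exact: prodr_gt0.
- exact: out_rate_ge0.
- by move=> x y xy; apply: le_lt_trans (flow_out_le x y fB fs) _; exact: ltry.
- exact: in_rate_ge0.
- by move=> x y xy; apply: le_lt_trans (flow_in_le xy fB fs) _; exact: ltry.
Qed.

End Necessity.

(** For the event [eta x = a] the outflow and inflow averages cancel, which gives
    [psi = - phi]. For the event [eta x = a], [eta y = b], with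
    [D a b = net a b - phi a + phi b], what remains is
    [p x y * D a b + p y x * D b a = 0]; exchanging [a] and [b] gives a second
    equation, and the determinant [p x y ^ 2 - p y x ^ 2] is not zero. *)
Lemma balanced_necessary : asymmetric_kernel p ->
  (forall t xi, uniq t ->
     \int[nu]_eta (generator p g (\1_(cylinder_event t xi)) eta)%:E = 0)%E ->
  balanced mu gs.
Proof.
move=> [x [y pxy]] inv.
have xy : x != y by apply: contraNneq pxy => ->.
have bal t xi : uniq t -> cylinder_flow t xi (in_rate mu gs) =
    cylinder_flow t xi (out_rate gs).
  by move=> ut; apply: cylinder_flow_balance => //; exact: inv.
have pyy : p y y = p x x.
  by rewrite -(p_transl x x (y - x)) addrCA subrr addr0.
have two_le u v : u != v -> p u u + p u v <= 1.
  move=> uv.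
  have us : uniq [:: u; v] by rewrite /= inE uv.
  have := escape (kernel_ge0 p_prob u) (kernel_out p_prob u) us ler01.
  move=> e; have : 0 <= (1 - \sum_(z <- [:: u; v]) p u z) * 1.
    rewrite -lee_fin -e; apply: esum_ge0 => z _; case: ifP => // _.
    by rewrite mule1 lee_fin (kernel_ge0 p_prob).
  by rewrite !big_cons big_nil; lra.
have := two_le x y xy; have := two_le y x; rewrite eq_sym xy => /(_ isT).
have := kernel_ge0 p_prob x y; have := kernel_ge0 p_prob y x.
pose phi a := mean_to (in_rate mu gs) a - mean_to (out_rate gs) a.
pose psi a := mean_from (in_rate mu gs) a - mean_from (out_rate gs) a.
pose net a b := in_rate mu gs a b - out_rate gs a b.
move=> pyx0 pxy0 h1 h2.
have phipsi a : psi a = - phi a.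
  have := bal [:: x] (fun=> a) isT; rewrite /cylinder_flow !big_cons !big_nil eqxx/=.
  rewrite !addr0 !add0r -!mulrDr => /eqP; rewrite -subr_eq0 -mulrBr mulf_eq0.
  case/orP => /eqP e; last by rewrite /psi /phi; move: e; lra.
  by exfalso; move/eqP: pxy; apply; lra.
have pair a b : p x y * (net a b - phi a + phi b) +
                p y x * (net b a - phi b + phi a) = 0.
  have uxy : uniq [:: x; y] by rewrite /= inE xy.
  have := bal [:: x; y] (fun z => if z == x then a else b) uxy.
  have yx : (y == x) = false by rewrite eq_sym (negPf xy).
  rewrite /cylinder_flow !big_cons !big_nil !eqxx yx (negPf xy)/=.
  rewrite pyy ?addr0 ?add0r.
  have from_to c : mean_from (in_rate mu gs) c = mean_from (out_rate gs) c -
      mean_to (in_rate mu gs) c + mean_to (out_rate gs) c.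
    by have := phipsi c; rewrite /phi /psi; lra.
  rewrite !from_to /phi /net; lra.
have net0 a b : net a b = phi a - phi b.
  have := pair a b; have := pair b a.
  move=> e1 e2; apply/eqP; rewrite -subr_eq0.
  set D := net a b - phi a + phi b in e2; set D' := net b a - phi b + phi a in e1.
  have : (p x y - p y x) * ((p x y + p y x) * D) = 0.
    have -> : (p x y - p y x) * ((p x y + p y x) * D) =
      p x y * (p x y * D + p y x * D') - p y x * (p x y * D' + p y x * D) by ring.
    rewrite /D /D' in e1 e2 *; rewrite e2.
    have -> : p x y * (net b a - phi b + phi a) + p y x * (net a b - phi a + phi b) = 0.
      by rewrite -[RHS]e1; ring.
    by ring.
  move/eqP; rewrite !mulf_eq0 => /orP[/eqP e|/orP[/eqP e|/eqP D0]].
  - by exfalso; move/eqP: pxy; apply; lra.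
  - by exfalso; move/eqP: pxy; apply; lra.
  - by apply/eqP; rewrite -[RHS]D0 /D; ring.
move=> a b; have := net0 a 0%N; have := net0 b 0%N; have := net0 a b.
by rewrite /net !in_rate0; lra.
Qed.

Section Sufficiency.
Variables (f : conf d -> R) (s : seq (lattice d)) (B : R).
Hypothesis us : uniq s.
Hypothesis fB : forall eta, 0 <= f eta <= B.
Hypothesis fs : depends_on s f.
Let f0 eta : 0 <= f eta. Proof. by case/andP: (fB eta). Qed.
Let r a := out_rate gs a 0.
Let r0 a : 0 <= r a. Proof. exact: out_rate_ge0. Qed.
Let e x : \bar R := (\int[nu]_eta (f eta * r (eta x))%:E)%E.

Let e0 : \bar R :=
  (\sum_(n <oo) (mu n)%:E * \int[nu]_eta (f eta * r n)%:E)%E.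

Let e_ge0 x : (0 <= e x)%E.
Proof. by rewrite /e; apply: integral_ge0 => eta _; rewrite lee_fin mulr_ge0. Qed.

Let e0_ge0 : (0 <= e0)%E.
Proof.
apply: nneseries_ge0 => n _ _; apply: mule_ge0; first by rewrite lee_fin ltW.
by apply: integral_ge0 => eta _; rewrite lee_fin mulr_ge0.
Qed.

Let e_fresh x : x \notin s -> e x = e0.
Proof.
move=> xs; rewrite /e (@integral_site _ _ _ _ nu_prod nu_marg mu_gt0 x (x :: s)
   (fun eta => f eta * r (eta x))).
- apply: eq_eseriesr => n _; congr (_ * _)%E; apply: eq_integral => eta _.
  by rewrite update_same (update_id _ _ fs).
- by move=> eta; rewrite mulr_ge0.
- move=> eta zeta h; rewrite (h x) ?inE ?eqxx//; congr (_ * _).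
  by apply: fs => z zs; rewrite h// inE zs orbT.
Qed.

Let e_fin x : e x = (fine (e x))%:E.
Proof.
have B0 : 0 <= B by case/andP: (fB (fun=> 0%N)) => /le_trans; exact.
have Bw n : 0 <= B * w n by rewrite mulr_ge0.
rewrite fineK// ge0_fin_numE//.
apply: (@le_lt_trans _ _
    (\int[nu]_eta ((B * w (eta x))%:E + (B * w 0)%:E))%E).
  apply: ge0_le_integral => //.
  - by move=> eta _; rewrite lee_fin mulr_ge0.
  - exact: (measurable_flow x x (fun a _ => r a) fs).
  - by apply: emeasurable_funD => //;
      exact: (measurable_coordinate_fun (fun n => B * w n)).
  - move=> eta _; have /andP[fe0 fBe] := fB eta.
    by rewrite -EFinD lee_fin -mulrDr ler_pM//; exact: out_le.
rewrite ge0_integralD//; first last.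
- by move=> eta _; rewrite lee_fin.
- exact: (measurable_coordinate_fun (fun n => B * w n)).
- by move=> eta _; rewrite lee_fin.
rewrite (expected_coordinate (q := fun n => B * w n))//.
rewrite [X in (_ + X)%E]integral_cst// [X in (_ + _ * X)%E]probability_setT mule1.
apply: lte_add_pinfty; last exact: ltry.
have -> : (\sum_(n <oo) (mu n * (B * w n))%:E =
           B%:E * \sum_(n <oo) (mu n * w n)%:E)%E.
  rewrite -nneseriesZl; last by move=> n _; rewrite lee_fin mulr_ge0// ltW.
  by apply: eq_eseriesr => n _; rewrite -EFinM mulrCA.
have : (0 <= \sum_(n <oo) (mu n * w n)%:E)%E.
  by apply: nneseries_ge0 => n _ _; rewrite lee_fin mulr_ge0// ltW.
by move: w_fin; case: (\sum_(n <oo) _)%E => // v _ _; rewrite -EFinM ltry.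
Qed.

(** With [e x] the expectation of [f eta * r (eta x)], the two sums are those of
    [p x y * e x] and of [p x y * e y] over the pairs that meet [s]. They agree
    because [e] is constant outside [s] and because each site sends and
    receives at the same total rate. *)
Lemma touching_sum_symmetric :
  exists T : R,
    touching_sum p s (flow f (fun a _ => r a)) = T%:E /\
    touching_sum p s (flow f (fun _ b => r b)) = T%:E.
Proof.
pose v x := fine (e x).
have ev0 x : 0 <= v x by rewrite fine_ge0.
have fresh x : x \notin s -> e x = (fine e0)%:E.
  by move=> xs; rewrite -(e_fresh xs) -e_fin.
rewrite /touching_sum.
rewrite (@esum_touches _ _ _ p_prob p_transl s _
  (fun x y => v x) v (fun=> fine e0))//; last first.
- by move=> y ys; rewrite fine_ge0//; split=> // x xs; exact: fresh.
- by move=> x xs; split=> // y ys; exact: e_fin.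
- by move=> x y xs ys xy; exact: e_fin.
- by move=> x y; exact: e_ge0.
rewrite (@esum_touches _ _ _ p_prob p_transl s _
  (fun x y => v y) (fun=> fine e0) v)//; last first.
- by move=> y ys; split=> // x xs; exact: e_fin.
- by move=> x xs; rewrite fine_ge0//; split=> // y ys; exact: fresh.
- by move=> x y xs ys xy; exact: e_fin.
eexists; split; first by []; congr EFin.
have diag (h : lattice d -> R) x : x \in s ->
    \sum_(y <- s | x != y) h y = \sum_(y <- s) h y - h x.
  move=> xs; rewrite (bigD1_seq x)//= addrC addrK.
  by apply: eq_bigl => y; rewrite eq_sym.
transitivity (\sum_(x <- s) v x * (1 - p x x) +
  (\sum_(y <- s) 1 - \sum_(x <- s) \sum_(y <- s) p x y) * fine e0).
  rewrite addrAC; congr (_ + _).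
    rewrite (exchange_big_dep xpredT)//= -big_split/=.
    apply: eq_big_seq => y ys; rewrite -big_distrl/=.
    rewrite (eq_bigl (fun x => y != x)); last by move=> x; rewrite eq_sym.
    by rewrite (diag (p^~ y))//; ring.
  by rewrite -big_distrl/= sumrB.
congr (_ + _).
  rewrite -big_split/=; apply: eq_big_seq => x xs.
  rewrite -big_distrl/= diag//; ring.
by rewrite -big_distrl/= sumrB exchange_big.
Qed.

Lemma flowD q1 q2 x y : (forall a b, 0 <= q1 a b) -> (forall a b, 0 <= q2 a b) ->
  flow f (fun a b => q1 a b + q2 a b) x y = (flow f q1 x y + flow f q2 x y)%E.
Proof.
move=> q10 q20; rewrite /flow /expected_flow -ge0_integralD//.
- by apply: eq_integral => eta _; rewrite -EFinD mulrDr.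
- by move=> eta _; rewrite lee_fin mulr_ge0.
- exact: measurable_flow fs.
- by move=> eta _; rewrite lee_fin mulr_ge0.
- exact: measurable_flow fs.
Qed.

Lemma touching_sumD F G : (forall x y, 0 <= F x y)%E -> (forall x y, 0 <= G x y)%E ->
  touching_sum p s (fun x y => F x y + G x y)%E =
  (touching_sum p s F + touching_sum p s G)%E.
Proof.
move=> F0 G0; rewrite /touching_sum -esumD.
- apply: eq_esum => i _; case: ifP; rewrite ?adde0// => _.
  by rewrite ge0_muleDr.
- by move=> i _; case: ifP => // _; rewrite mule_ge0// lee_fin (kernel_ge0 p_prob).
- by move=> i _; case: ifP => // _; rewrite mule_ge0// lee_fin (kernel_ge0 p_prob).
Qed.

(** [balanced] reads [in_rate a b + r a = out_rate a b + r b]. Stated as an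
    equality of nonnegative functions, it can be integrated and summed without
    any integrability condition. *)
Lemma balanced_expectation0 : balanced mu gs ->
  nu.-integrable setT (EFin \o (generator p g f : confM d -> R)) /\
  (\int[nu]_eta (generator p g f eta)%:E = 0)%E.
Proof.
move=> bal.
have [gfin lfin ? ->] := generator_expectation us fB fs; split=> //.
have in0 := in_rate_ge0 mu_gt0 gs_ge0; have out0 := out_rate_ge0 gs_ge0.
have [T [T1 T2]] := touching_sum_symmetric.
have : (touching_sum p s (flow f (in_rate mu gs)) + T%:E =
        touching_sum p s (flow f (out_rate gs)) + T%:E)%E.
  rewrite -{1}T1 -T2 -!touching_sumD; try by move=> x y; exact: flow_ge0.
  congr touching_sum; apply/funext => x; apply/funext => y.
  rewrite -!flowD//; congr expected_flow; apply/funext => a; apply/funext => b.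
  by have := bal a b; rewrite /r; lra.
move: gfin lfin.
have : (0 <= touching_sum p s (flow f (in_rate mu gs)))%E.
  apply: esum_ge0 => i _; case: ifP => // _.
  by rewrite mule_ge0// ?lee_fin ?(kernel_ge0 p_prob)// flow_ge0.
have : (0 <= touching_sum p s (flow f (out_rate gs)))%E.
  apply: esum_ge0 => i _; case: ifP => // _.
  by rewrite mule_ge0// ?lee_fin ?(kernel_ge0 p_prob)// flow_ge0.
case: touching_sum => [P| |]//; case: touching_sum => [N| |]// _ _ _ _.
by rewrite -!EFinD => -[e']; rewrite (_ : P = N) ?subrr//; lra.
Qed.

End Sufficiency.

(** The generator only sees increments, so a bounded function may be made
    nonnegative by adding a constant. *)
Lemma balanced_sufficient f B : balanced mu gs -> cylinder_fun f ->
  (forall eta, `|f eta| <= B) ->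
  nu.-integrable setT (EFin \o (generator p g f : confM d -> R)) /\
  (\int[nu]_eta (generator p g f eta)%:E = 0)%E.
Proof.
move=> bal [s fs] fB.
have genE : generator p g f = generator p g (fun eta => f eta + B).
  apply/funext => eta; rewrite /generator; congr rsum.
  by apply/funext => -[[x y] k]; congr (_ * _); ring.
rewrite genE; apply: (@balanced_expectation0 _ (undup s) (B + B)) => //.
- exact: undup_uniq.
- by move=> eta; have := fB eta; rewrite ler_norml; lra.
- by move=> eta zeta h; rewrite (fs eta zeta)// => z zs; apply: h; rewrite mem_undup.
Qed.

End Balance.

(** * Constancy from a zero right derivative, and dominated signed sums *)

Section RightDerivative.
Variables (R : realType) (u : R -> R).
Hypothesis u_right : forall (t : R) (h : nat -> R), 0 <= t ->
  (forall n, 0 < h n <= 1) -> h n @[n --> \oo] --> (0 : R) ->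
  (u (t + h n) - u t) / h n @[n --> \oo] --> (0 : R).
Hypothesis u_cont : forall (t : R) (r : nat -> R), 0 <= t ->
  (forall n, 0 <= r n) -> r n @[n --> \oo] --> t ->
  u (r n) @[n --> \oo] --> u t.

Lemma inv_succ_cvg0 : (n.+1%:R^-1 : R) @[n --> \oo] --> (0 : R).
Proof. exact: (@cvg_harmonic R). Qed.

(** If no [dlt] worked, there would be increments [h n <= (n + 1)^-1] along which
    the difference quotient stays above [e]. *)
Lemma right_increment_small t e : 0 <= t -> 0 < e ->
  exists2 dlt : R, 0 < dlt & forall h, 0 < h <= dlt ->
    `|u (t + h) - u t| <= e * h.
Proof.
move=> t0 e0; apply: contrapT => none.
have bad n : exists h : R, 0 < h <= n.+1%:R^-1 /\ e * h < `|u (t + h) - u t|.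
  apply: contrapT => H; apply: none; exists n.+1%:R^-1; first by rewrite invr_gt0.
  by move=> h hh; rewrite leNgt; apply/negP => lt; apply: H; exists h.
have [h hP] := choice bad.
have h0 n : 0 < h n by case: (hP n) => /andP[].
have hle n : h n <= n.+1%:R^-1 by case: (hP n) => /andP[].
have hcvg : h n @[n --> \oo] --> (0 : R).
  apply: (@squeeze_cvgr _ _ _ _ (fun=> 0) (fun n => n.+1%:R^-1)).
  - by apply: nearW => n; rewrite hle ltW// h0.
  - exact: cvg_cst.
  - exact: inv_succ_cvg0.
have h1 n : 0 < h n <= 1.
  by rewrite h0 (le_trans (hle n))// invf_le1// ler1n.
have /cvgr0Pnorm_lt /(_ e e0) [N _ /(_ N (leqnn N))/=] := u_right t0 h1 hcvg.
have [_ lt] := hP N.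
by rewrite normf_div (ger0_norm (ltW (h0 N))) ltr_pdivrMr// ltNge (ltW lt).
Qed.

(** For a fixed slope [e > 0], the supremum [m] of the times up to which
    [`|u r - u 0| <= e * r] holds is one of these times by continuity, and the
    right derivative at [m] allows the bound to be continued beyond [m], unless
    [m = t]. *)
Lemma zero_right_derivative_cst t : 0 <= t -> u t = u 0.
Proof.
move=> t0; apply/eqP; rewrite -subr_eq0 -normr_le0.
have [->|tn0] := eqVneq t 0; first by rewrite subrr normr0.
have tgt0 : 0 < t by rewrite lt_def tn0.
rewrite leNgt; apply/negP => gap.
(* This slope is too small for the assumed gap between [u t] and [u 0]. *)
pose e := `|u t - u 0| / (2 * t).
have e0 : 0 < e by rewrite divr_gt0// mulr_gt0.
suff : `|u t - u 0| <= e * t.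
  rewrite /e (_ : `|u t - u 0| / (2 * t) * t = `|u t - u 0| / 2); first by lra.
  by field; rewrite tn0.
pose A : set R := [set s | 0 <= s <= t /\
  forall r, 0 <= r <= s -> `|u r - u 0| <= e * r].
have A0 : A 0.
  split; first by rewrite lexx ltW.
  by move=> r r0; rewrite (_ : r = 0) ?subrr ?normr0 ?mulr0//; lra.
have supA : has_sup A.
  by split; [exists 0|exists t => s [/andP[]]].
pose m := sup A.
have m0 : 0 <= m by apply: ub_le_sup => //; exact: supA.2.
have mt : m <= t by apply: ge_sup; [exists 0|move=> s [/andP[]]].
have below r : 0 <= r < m -> `|u r - u 0| <= e * r.
  move=> /andP[r0 rm].
  have [|s [_ sP] rs] := @sup_adherent _ A (m - r) _ supA; first by rewrite subr_gt0.
  by apply: sP; rewrite r0/=; move: rs; rewrite -/m; lra.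
have Am : A m.
  split; first by rewrite m0 mt.
  move=> r /andP[r0]; rewrite le_eqVlt => /predU1P[->|rm]; last first.
    by apply: below; rewrite r0.
  have [->|mn0] := eqVneq m 0; first by rewrite subrr normr0 mulr0.
  have mgt0 : 0 < m by rewrite lt_def mn0.
  pose s n : R := m - m * n.+1%:R^-1.
  have sP n : 0 <= s n < m.
    rewrite /s subr_ge0 gtrBl mulr_gt0// andbT.
    by rewrite -[leRHS]mulr1 ler_wpM2l// invf_le1// ler1n.
  have scvg : s n @[n --> \oo] --> m.
    rewrite -[X in _ --> X]subr0 -[X in _ - X](mulr0 m).
    by apply: cvgB; [exact: cvg_cst|apply: cvgMr; exact: inv_succ_cvg0].
  have ucvg : `|u (s n) - u 0| @[n --> \oo] --> `|u m - u 0|.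
    apply: cvg_norm; apply: cvgB; last exact: cvg_cst.
    by apply: u_cont => // n; case/andP: (sP n).
  apply: (cvgr_to_le ucvg); apply: nearW => n.
  apply: le_trans (below _ (sP n)) _.
  by rewrite ler_wpM2l// ltW//; case/andP: (sP n).
have [mlt|] := ltP m t; last by move=> tm; apply: Am.2; rewrite t0.
have [dlt dlt0 small] := right_increment_small m0 e0.
pose h := Num.min dlt (t - m).
have h0 : 0 < h by rewrite lt_min dlt0 subr_gt0.
have hd : h <= dlt by rewrite ge_min lexx.
have ht : h <= t - m by rewrite ge_min lexx orbT.
have : A (m + h).
  split; first by lra.
  move=> r /andP[r0 rh]; have [rm|mr] := leP r m.
    by apply: Am.2; rewrite r0.
  have : `|u (m + (r - m)) - u m| <= e * (r - m) by apply: small; lra.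
  have : `|u m - u 0| <= e * m by apply: Am.2; rewrite m0 lexx.
  rewrite subrKC => h1 h2.
  rewrite (_ : u r - u 0 = (u r - u m) + (u m - u 0)); last by ring.
  by apply: le_trans (ler_normD _ _) _; lra.
move=> /(ub_le_sup supA.2); rewrite -/m; lra.
Qed.

End RightDerivative.

Section SignedSums.
Variables (R : realType) (I : countType) (A : set I).
Implicit Types (u v l : I -> R).

Let restr u i := if i \in A then u i else 0.

Let pos u i := Num.max (restr u i) 0.

Let rsumE u : rsum A u = fine (\esum_(i in [set: I]) (pos u i)%:E -
  \esum_(i in [set: I]) (pos (fun i => - u i) i)%:E)%E.
Proof.
rewrite /rsum esum_mkcond [in X in (_ - X)%E]esum_mkcond.
congr (fine (_ - _)); apply: eq_esum => i _; rewrite /pos /restr; case: ifP => //.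
  by rewrite maxxx.
by rewrite maxxx.
Qed.

Let pos_bound u v i : `|u i| <= v i -> 0 <= pos u i <= v i.
Proof.
move=> uv; rewrite /pos /restr le_max lexx orbT ge_max/=.
have v0 : 0 <= v i by exact: le_trans uv.
rewrite v0 andbT; case: ifP => // _.
by apply: le_trans uv; exact: ler_norm.
Qed.

Let pos_fin u v : (forall i, `|u i| <= v i) ->
  (\esum_(i in [set: I]) (v i)%:E < +oo)%E ->
  (\esum_(i in [set: I]) (pos u i)%:E)%E \is a fin_num.
Proof.
move=> uv v_fin; rewrite ge0_fin_numE; last first.
  by apply: esum_ge0 => i _; rewrite lee_fin; case/andP: (pos_bound (uv i)).
apply: le_lt_trans v_fin; apply: le_esum => i _.
by rewrite lee_fin; case/andP: (pos_bound (uv i)).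
Qed.

Lemma rsum_le u v : (forall i, `|u i| <= v i) ->
  (\esum_(i in [set: I]) (v i)%:E < +oo)%E ->
  (`|rsum A u|%:E <= \esum_(i in [set: I]) (v i)%:E)%E.
Proof.
move=> uv v_fin; rewrite rsumE.
have uvN i : `|- u i| <= v i by rewrite normrN.
have Pf := pos_fin uv v_fin; have Nf := pos_fin uvN v_fin.
rewrite fineB//.
apply: (@le_trans _ _ (\esum_(i in [set: I]) (pos u i)%:E +
    \esum_(i in [set: I]) (pos (fun i => - u i) i)%:E)%E).
  rewrite -(fineK Pf) -(fineK Nf) -EFinD lee_fin.
  apply: le_trans (ler_normB _ _) _.
  have s0 u' : 0 <= fine (\esum_(i in [set: I]) (pos u' i)%:E)%E.
    apply: fine_ge0; apply: esum_ge0 => i _.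
    by rewrite lee_fin le_max lexx orbT.
  by rewrite (ger0_norm (s0 u)) (ger0_norm (s0 (fun i => - u i))).
rewrite -esumD; try by move=> i _; rewrite lee_fin le_max lexx orbT.
apply: le_esum => i _; rewrite -EFinD lee_fin; have := uv i.
rewrite /pos /restr; case: ifP => _; last by rewrite maxxx addr0; exact: le_trans.
rewrite ler_norml /Num.max => /andP[h1 h2].
by case: (ltP (u i) 0) => h3; case: (ltP (- u i) 0) => h4; lra.
Qed.

Lemma rsum_dominated (u : nat -> I -> R) l v :
  (forall n i, `|u n i| <= v i) ->
  (forall i, u n i @[n --> \oo] --> l i) ->
  (\esum_(i in [set: I]) (v i)%:E < +oo)%E ->
  rsum A (u n) @[n --> \oo] --> rsum A l.
Proof.
move=> uv ul v_fin.
have uvN n i : `|- u n i| <= v i by rewrite normrN.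
have lv i : `|l i| <= v i.
  by apply: (cvgr_to_le (cvg_norm (ul i))); apply: nearW => n; exact: uv.
have lvN i : `|- l i| <= v i by rewrite normrN.
have pos_cvg (u' : nat -> I -> R) l' : (forall n i, `|u' n i| <= v i) ->
    (forall i, u' n i @[n --> \oo] --> l' i) ->
    (\esum_(i in [set: I]) (pos (u' n) i)%:E @[n --> \oo] -->
     \esum_(i in [set: I]) (pos l' i)%:E)%E.
  move=> u'v u'l'; apply: (esum_dominated (v := v)) => //.
    by move=> n i; exact: pos_bound.
  move=> i; rewrite /pos /restr; case: ifP => _.
    under eq_fun do rewrite maxr_absE !addr0 subr0.
    rewrite maxr_absE addr0 subr0; apply: cvgMl.
    by apply: cvgD; [exact: u'l'|apply: cvg_norm; exact: u'l'].
  exact: cvg_cst.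
have ulN i : - u n i @[n --> \oo] --> - l i by exact: cvgN.
rewrite rsumE; under eq_fun do rewrite rsumE.
apply: fine_cvg; rewrite fineK; last first.
  by rewrite fin_numB (pos_fin lv v_fin) (pos_fin lvN v_fin).
apply: cvgeB.
- by rewrite fin_num_adde_defr// (pos_fin lv v_fin).
- exact: pos_cvg.
- exact: (pos_cvg (fun n i => - u n i) (fun i => - l i)).
Qed.

End SignedSums.

(** * Truncation of configurations *)

Section Truncation.
Variables (R : realType) (d : nat) (a : lattice d -> R).
Hypothesis a_gt0 : forall x, 0 < a x.
Implicit Types (eta zeta : conf d) (f : conf d -> R).

Let a_ge0 x : 0 <= a x. Proof. exact: ltW. Qed.
Let X := finite_confs a.

(** The sites with index below [n] in an enumeration of the lattice. *)
Definition window (n : nat) : seq (lattice d) :=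
  undup (pmap (fun k => unpickle k : option (lattice d)) (iota 0 n)).

Lemma mem_window n x : (pickle x < n)%N -> x \in window n.
Proof.
move=> xn; rewrite mem_undup mem_pmap; apply/mapP; exists (pickle x).
  by rewrite mem_iota.
by rewrite pickleK.
Qed.

Definition truncate (n : nat) eta : conf d :=
  fun x => if (pickle x < n)%N then eta x else 0%N.

Lemma truncate_depends n (T : Type) (f : conf d -> T) :
  depends_on (window n) (fun eta => f (truncate n eta)).
Proof.
move=> eta zeta e; congr f; apply/funext => x; rewrite /truncate.
by case: ifP => // /mem_window /e.
Qed.

Lemma truncate_finite n eta : X (truncate n eta).
Proof.
rewrite /X /finite_confs /= /cnorm.
apply: (@le_lt_trans _ _ (\esum_(x in [set: lattice d])
   (if x \in window n then ((eta x)%:R * a x)%:E else 0))%E).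
  apply: le_esum => x _; rewrite /truncate; case: ifP => [/mem_window ->//|_].
  by rewrite mul0r; case: ifP => // _; rewrite lee_fin mulr_ge0.
rewrite (esum_seq (a := fun x => ((eta x)%:R * a x)%:E)) ?undup_uniq//.
  by rewrite sumEFin ltry.
by move=> x; rewrite lee_fin mulr_ge0.
Qed.

Lemma truncate_cvg eta : X eta ->
  (cdist a (truncate n eta) eta @[n --> \oo] --> 0%E).
Proof.
move=> Xeta.
rewrite (_ : 0%E = (\esum_(x in [set: lattice d]) ((fun=> 0) x)%:E)%E); last first.
  by rewrite esum1.
apply: (esum_dominated (v := fun x => (eta x)%:R * a x)) => //.
- move=> n x; rewrite mulr_ge0//= ler_wpM2r// /truncate; case: ifP => _.
    by rewrite subrr normr0.
  by rewrite sub0r normrN normr_nat.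
- move=> x; apply: cvg_near_cst; near=> n; rewrite /truncate.
  by rewrite ifT ?subrr ?normr0 ?mul0r//; near: n; exact: nbhs_infty_gt.
Unshelve. all: by end_near. Qed.

(** This is what makes a Lipschitz function on the configurations of finite norm
    a limit of cylinder functions, hence measurable. *)
Lemma lipschitz_truncate_cvg L f eta : lipschitz_with a X L f -> X eta ->
  f (truncate n eta) @[n --> \oo] --> f eta.
Proof.
move=> [L0 fL] Xeta; apply/cvgrPdist_lt => e e0.
have /fine_cvgP[fin] := truncate_cvg Xeta.
move=> /cvgr0Pnorm_lt /(_ (e / L)) /(_ (divr_gt0 e0 L0)) small.
near=> n.
have dfin : cdist a (truncate n eta) eta \is a fin_num by near: n.
have lt : `|fine (cdist a (truncate n eta) eta)| < e / L by near: n.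
rewrite distrC -lte_fin; apply: le_lt_trans (fL _ _ (truncate_finite n eta) Xeta) _.
rewrite -(fineK dfin) -EFinM lte_fin mulrC -ltr_pdivlMr//.
by apply: le_lt_trans lt; exact: ler_norm.
Unshelve. all: by end_near. Qed.

Lemma cnorm_ge0 eta : (0 <= cnorm a eta)%E.
Proof. by apply: esum_ge0 => x _; rewrite lee_fin mulr_ge0. Qed.

Lemma measurable_cnorm : measurable_fun [set: confM d] (cnorm a : confM d -> \bar R).
Proof.
apply: measurable_esum => [x|x eta]; last by rewrite lee_fin mulr_ge0.
exact: (measurable_coordinate_fun (fun n => n%:R * a x)).
Qed.

Lemma measurable_finite_confs : measurable (X : set (confM d)).
Proof.
rewrite (_ : X = [set: confM d] `&` [set eta | (cnorm a eta < +oo)%E]).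
  by apply: emeasurable_fun_infty_o => //; exact: measurable_cnorm.
by rewrite setTI.
Qed.

Lemma Lip_measurable f : Lip a X f -> measurable_fun (X : set (confM d)) (f : confM d -> R).
Proof.
move=> [L fL].
apply: (measurable_fun_cvg (h := fun n (eta : confM d) => f (truncate n eta))).
  move=> n; apply: measurable_funTS.
  exact: measurable_depends_on (@truncate_depends n _ f).
by move=> eta Xeta; exact: lipschitz_truncate_cvg fL Xeta.
Qed.

(** If the indicator differs at two configurations, these differ by at least one
    particle at some [x] in [t], and are at distance at least [a x]. *)
Lemma cylinder_event_Lip t xi :
  Lip a X (\1_(cylinder_event t xi) : conf d -> R).
Proof.
pose L := 1 + \sum_(x <- t) (a x)^-1.
have L0 : 0 < L.
  by rewrite ltr_pwDl// sumr_ge0// => x _; rewrite invr_ge0.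
exists L; split=> // eta zeta _ _.
have d0 : (0 <= cdist a eta zeta)%E.
  by apply: esum_ge0 => x _; rewrite lee_fin mulr_ge0.
have [[x [xt ne]]|none] := pselect (exists x, x \in t /\ eta x != zeta x);
    last first.
  rewrite (@depends_on_cylinder R d t xi eta zeta).
    by rewrite subrr normr0 mule_ge0// lee_fin ltW.
  by move=> x xt; apply/eqP/negPn/negP => ne; apply: none; exists x.
apply: (@le_trans _ _ (L * a x)%:E).
  rewrite lee_fin; apply: (@le_trans _ _ 1).
    rewrite !indicE; case: (_ \in _); case: (_ \in _); rewrite ?subrr ?normr0//.
      by rewrite subr0 normr1.
    by rewrite sub0r normrN1.
  rewrite -ler_pdivrMr// mul1r /L (big_rem x)//= addrCA lerDl.
  by rewrite addr_ge0// sumr_ge0// => y _; rewrite invr_ge0.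
rewrite EFinM; apply: lee_wpmul2l; first by rewrite lee_fin ltW.
apply: (@le_trans _ _ (`|(eta x)%:R - (zeta x)%:R| * a x)%:E).
  rewrite lee_fin ler_peMl//.
  have [lt|lt|e] := ltngtP (eta x) (zeta x); last by rewrite e eqxx in ne.
    by rewrite distrC -natrB ?normr_nat ?ler1n ?subn_gt0// ltnW.
  by rewrite -natrB ?normr_nat ?ler1n ?subn_gt0// ltnW.
rewrite /cdist (esumID [set x])//; last by move=> y _; rewrite lee_fin mulr_ge0.
rewrite setTI esum_set1; last by rewrite lee_fin mulr_ge0.
by rewrite leeDl//; apply: esum_ge0 => y _; rewrite lee_fin mulr_ge0.
Qed.

Let bump (k : nat) (x y z : lattice d) : \bar R :=
  if z \in [:: x; y] then (k%:R * a z)%:E else 0%E.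

Let esum_bump k x y : x != y ->
  (\esum_(z in [set: lattice d]) bump k x y z = (k%:R * (a x + a y))%:E)%E.
Proof.
move=> xy; rewrite (esum_seq (a := fun z => (k%:R * a z)%:E)).
- by rewrite !big_cons big_nil adde0 -EFinD mulrDr.
- by rewrite /= inE xy.
- by move=> z; rewrite lee_fin mulr_ge0.
Qed.

Lemma moveE k x y eta : move k x y eta = eta \/
  x != y /\ forall z, move k x y eta z = (if z == x then (eta x - k)%N
             else if z == y then (eta y + k)%N else eta z).
Proof.
rewrite /move; case: ifP => [/andP[_ xy]|_]; last by left.
by right.
Qed.

Lemma cdist_move n k x y eta :
  (cdist a (truncate n (move k x y eta)) (truncate n eta)
    <= (k%:R * (a x + a y))%:E)%E.
Proof.
have [->|[xy mvE]] := moveE k x y eta.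
  rewrite /cdist esum1 ?lee_fin ?mulr_ge0// ?addr_ge0// => z _.
  by rewrite subrr normr0 mul0r.
rewrite -esum_bump//; apply: le_esum => z _.
rewrite /bump /truncate; case: (pickle z < n)%N; last first.
  by rewrite subrr normr0 mul0r; case: ifP; rewrite ?lee_fin ?mulr_ge0.
rewrite mvE !inE; case: eqVneq => [->|zx]/=.
  rewrite lee_fin ler_wpM2r// ler_norml.
  have h1 : (eta x <= (eta x - k) + k)%N by lia.
  have : (eta x)%:R <= (eta x - k)%:R + k%:R :> R by rewrite -natrD ler_nat.
  have : (eta x - k)%:R <= (eta x)%:R :> R by rewrite ler_nat leq_subr.
  by have : 0 <= k%:R :> R by []; lra.
case: eqVneq => [->|zy].
  by rewrite lee_fin natrD addrAC subrr add0r normr_nat.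
by rewrite subrr normr0 mul0r.
Qed.

Lemma move_finite k x y eta : X eta -> X (move k x y eta).
Proof.
move=> Xeta; have [->//|[xy mvE]] := moveE k x y eta.
apply: (@le_lt_trans _ _ (cnorm a eta + (k%:R * (a x + a y))%:E)%E); last first.
  by apply: lte_add_pinfty => //; rewrite ltry.
rewrite -esum_bump// -esumD; last 2 first.
- by move=> z _; rewrite lee_fin mulr_ge0.
- by move=> z _; rewrite /bump; case: ifP; rewrite ?lee_fin ?mulr_ge0.
apply: le_esum => z _; rewrite mvE /bump !inE; case: eqVneq => [->|zx]/=.
  rewrite -EFinD lee_fin -mulrDl ler_wpM2r// -natrD ler_nat; lia.
case: eqVneq => [->|zy]; last by rewrite adde0.
by rewrite -EFinD lee_fin -mulrDl -natrD.
Qed.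

End Truncation.

(** * The generator on Lipschitz functions *)

Lemma linear_weight_fin (R : realType) (mu : nat -> R) (C : R) :
  (forall n, 0 < mu n) -> finite_first_moment mu -> 0 < C ->
  (\sum_(n <oo) (mu n * (C * n%:R))%:E < +oo)%E.
Proof.
move=> mu_gt0 moment C0.
have nmu n : (0 <= (n%:R * mu n)%:E)%E by rewrite lee_fin mulr_ge0// ltW.
rewrite (_ : (\sum_(n <oo) (mu n * (C * n%:R))%:E =
   C%:E * \sum_(n <oo) (n%:R * mu n)%:E)%E); last first.
  rewrite -nneseriesZl//.
  by apply: eq_eseriesr => n _; rewrite -EFinM; congr EFin; ring.
have : (0 <= \sum_(n <oo) (n%:R * mu n)%:E)%E by exact: nneseries_ge0.
move: moment; rewrite /finite_first_moment.
by case: (\sum_(n <oo) _)%E => // r _ _; rewrite -EFinM ltry.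
Qed.

Lemma constant_weight_fin (R : realType) (d : nat) (nu : probability (confM d) R)
    (mu : nat -> R) (C : R) : site_marginal nu mu -> 0 < C ->
  (\sum_(n <oo) (mu n * C)%:E < +oo)%E.
Proof.
move=> nu_marg C0.
have mu0 n : 0 <= mu n.
  by rewrite -lee_fin -(nu_marg 0 n) measure_ge0.
rewrite (_ : (\sum_(n <oo) (mu n * C)%:E = C%:E * \sum_(n <oo) (mu n)%:E)%E);
    last first.
  rewrite -nneseriesZl; last by move=> n _; rewrite lee_fin.
  by apply: eq_eseriesr => n _; rewrite -EFinM mulrC.
rewrite (_ : (\sum_(n <oo) (mu n)%:E = 1)%E); first by rewrite mule1 ltry.
rewrite -(probability_setT nu).
rewrite (_ : setT = \bigcup_n ([set eta : conf d | eta 0 = n] : set (confM d)));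
    last by apply/seteqP; split=> // eta _; exists (eta 0).
rewrite measure_bigcup//.
- rewrite [RHS]eseries_mkcond; apply: eq_eseriesr => n _; rewrite in_setT; exact: esym (nu_marg 0 n).
- by move=> n _; exact: measurable_coordinate.
- by move=> n m _ _ [eta [/= <- <-]].
Qed.

Section Activity.
Variables (R : realType) (d : nat) (p : lattice d -> lattice d -> R).
Hypothesis p_prob : transition_probability p.
Hypothesis p_transl : translation_invariant_kernel p.
Variables (a : lattice d -> R) (M : R).
Hypothesis a_adm : admissible_weight p a M.
Variable gs : nat -> nat -> R.
Hypothesis gs_ge0 : forall k b, (0 < k)%N -> 0 <= gs k b.
Variable C : R.
Hypothesis C0 : 0 < C.
Hypothesis growth : forall alpha beta, (0 < alpha)%N ->
  \sum_(1 <= k < alpha.+1) k%:R * gs k beta <= C * (alpha + beta)%:R.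
Implicit Types (eta zeta : conf d) (f : conf d -> R).

Let g := MMTP_rates gs.
Let X := finite_confs a.

Let a_gt0 x : 0 < a x. Proof. by case: a_adm. Qed.
Let a_ge0 x : 0 <= a x. Proof. exact: ltW. Qed.
Let M0 : 0 < M. Proof. by case: a_adm. Qed.
Let p0 x y : 0 <= p x y. Proof. exact: kernel_ge0. Qed.

Lemma growth_all al be :
  \sum_(1 <= k < al.+1) k%:R * gs k be <= C * (al + be)%:R.
Proof.
have [->|al0] := posnP al; last exact: growth.
by rewrite big_geq// mulr_ge0// ltW.
Qed.

Lemma growth_out_rate al be :
  out_rate gs al be <= C * al%:R + C * be%:R.
Proof.
rewrite -mulrDr -natrD; apply: le_trans (growth_all al be).
rewrite /out_rate big_nat_cond [leRHS]big_nat_cond.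
apply: ler_sum => k /andP[/andP[k0 _] _].
by rewrite ler_peMl ?gs_ge0// ler1n.
Qed.

Lemma kg_ge0 k b : 0 <= k%:R * gs k b.
Proof. by have [->|k0] := posnP k; rewrite ?mul0r// mulr_ge0 ?gs_ge0. Qed.

(** Expanding the product gives four sums. In two of them weight and occupation
    belong to the same site, and the kernel sums to one. The other two are what
    the constant [M] of an admissible weight controls. *)
Lemma weighted_pairs_le eta :
  (\esum_(i in [set: lattice d * lattice d])
     (p i.1 i.2 * ((a i.1 + a i.2) * (eta i.1 + eta i.2)%:R))%:E
   <= (2 + M)%:E * cnorm a eta)%E.
Proof.
pose e x : R := (eta x)%:R.
have e0 x : 0 <= e x by rewrite /e.
pose s1 x y : \bar R := ((e x * a x)%:E * (p x y)%:E)%E.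
pose s2 x y : \bar R := ((e y * a y)%:E * (p x y)%:E)%E.
pose s3 x y : \bar R := ((e x)%:E * (p x y * a y)%:E)%E.
pose s4 x y : \bar R := ((e y)%:E * (a x * p x y)%:E)%E.
have s10 x y : (0 <= s1 x y)%E by rewrite /s1 -EFinM lee_fin !mulr_ge0.
have s20 x y : (0 <= s2 x y)%E by rewrite /s2 -EFinM lee_fin !mulr_ge0.
have s30 x y : (0 <= s3 x y)%E by rewrite /s3 -EFinM lee_fin !mulr_ge0.
have s40 x y : (0 <= s4 x y)%E by rewrite /s4 -EFinM lee_fin !mulr_ge0.
rewrite (_ : (\esum_(i in _) _ = \esum_(i in [set: lattice d * lattice d])
    (s1 i.1 i.2 + s2 i.1 i.2 + (s3 i.1 i.2 + s4 i.1 i.2)))%E); last first.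
  apply: eq_esum => -[x y] _ /=; rewrite /s1 /s2 /s3 /s4 -!EFinM -!EFinD.
  by congr EFin; rewrite natrD -/(e x) -/(e y); ring.
rewrite !esumD; try by move=> i _; rewrite ?adde_ge0.
rewrite (esum_pair s10) (esum_pair_swap s20) (esum_pair s30) (esum_pair_swap s40).
have -> : (\esum_(x in [set: lattice d]) \esum_(y in [set: lattice d]) s1 x y =
    cnorm a eta)%E.
  apply: eq_esum => x _; rewrite esumZl ?mulr_ge0//; last first.
    by move=> y _; rewrite lee_fin.
  by rewrite (kernel_out p_prob) mule1.
have -> : (\esum_(y in [set: lattice d]) \esum_(x in [set: lattice d]) s2 x y =
    cnorm a eta)%E.
  apply: eq_esum => y _; rewrite esumZl ?mulr_ge0//; last first.
    by move=> x _; rewrite lee_fin.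
  by rewrite (kernel_in p_prob p_transl) mule1.
rewrite EFinD ge0_muleDl ?lee_fin ?(ltW M0)//.
apply: leeD; first by rewrite mule_natl mule2n.
rewrite -esumD; last 2 first.
- by move=> x _; apply: esum_ge0.
- by move=> x _; apply: esum_ge0.
rewrite -esumZl ?(ltW M0)//; last by move=> x _; rewrite lee_fin mulr_ge0.
apply: le_esum => x _; rewrite !esumZl//; last 2 first.
- by move=> y _; rewrite lee_fin mulr_ge0.
- by move=> y _; rewrite lee_fin mulr_ge0.
rewrite -ge0_muleDr; last 2 first.
- by apply: esum_ge0 => y _; rewrite lee_fin mulr_ge0.
- by apply: esum_ge0 => y _; rewrite lee_fin mulr_ge0.
rewrite -EFinM mulrCA EFinM; apply: lee_wpmul2l; first by rewrite lee_fin.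
by case: a_adm.
Qed.

(** A jump of [k] particles from [x] to [y] moves the configuration by at most
    [k * (a x + a y)], so this bounds a summand of the generator applied to a
    function with Lipschitz constant [L]. *)
Definition activity (L : R) eta (i : lattice d * lattice d * nat) : R :=
  p i.1.1 i.1.2 * g i.2 (eta i.1.1) (eta i.1.2) *
    (L * (i.2%:R * (a i.1.1 + a i.1.2))).

Lemma activity_le L eta : 0 <= L ->
  (\esum_(i in [set: lattice d * lattice d * nat]) (activity L eta i)%:E
    <= (L * C * (2 + M))%:E * cnorm a eta)%E.
Proof.
move=> L0.
pose act (xy : lattice d * lattice d) k := (activity L eta (xy, k))%:E.
have act0 xy k : (0 <= act xy k)%E.
  have aa : 0 <= a xy.1 + a xy.2 by rewrite addr_ge0.
  rewrite lee_fin /activity/= /g /MMTP_rates; case: ifP => [/andP[k0 _]|_].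
    by rewrite !mulr_ge0// gs_ge0.
  by rewrite mulr0 mul0r.
rewrite (_ : (\esum_(i in _) _ = \esum_(i in [set: lattice d * lattice d * nat])
   act i.1 i.2)%E); last by apply: eq_esum => -[].
rewrite (esum_pair act0) EFinM -muleA.
apply: le_trans (lee_wpmul2l _ (weighted_pairs_le eta)); last first.
  by rewrite lee_fin mulr_ge0// ltW.
rewrite -esumZl; last 2 first.
- by rewrite mulr_ge0// ltW.
- by move=> i _; rewrite lee_fin mulr_ge0// mulr_ge0// addr_ge0.
apply: le_esum => -[x y] _ /=.
pose c := p x y * (L * (a x + a y)).
have c0 : 0 <= c by rewrite mulr_ge0// mulr_ge0// addr_ge0.
rewrite (_ : (\esum_(k in _) _ = \esum_(k in [set: nat])
   (if (0 < k <= eta x)%N then c * (k%:R * gs k (eta y)) else 0)%:E)%E); last first.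
  apply: eq_esum => k _; congr EFin; rewrite /activity/= /g /MMTP_rates.
  by case: ifP => _; [rewrite /c; ring|rewrite mulr0 mul0r].
rewrite (esum_range (h := fun k => c * (k%:R * gs k (eta y)))); last first.
  by move=> k; rewrite mulr_ge0// kg_ge0.
rewrite -EFinM lee_fin -big_distrr/=.
rewrite (_ : L * C * _ = c * (C * (eta x + eta y)%:R)); last by rewrite /c; ring.
by rewrite ler_wpM2l// growth_all.
Qed.

Lemma truncated_generator_summand f L n eta i : lipschitz_with a X L f ->
  `| let: (x, y, k) := i in p x y * g k (eta x) (eta y) *
       (f (truncate n (move k x y eta)) - f (truncate n eta))| <= activity L eta i.
Proof.
move=> [L0 fL]; case: i => -[x y] k; rewrite /activity/= normrM.
rewrite (@ger0_norm _ (_ * g _ _ _)); last first.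
  by rewrite mulr_ge0// /g /MMTP_rates; case: ifP => // /andP[/gs_ge0].
apply: ler_wpM2l.
  by rewrite mulr_ge0// /g /MMTP_rates; case: ifP => // /andP[/gs_ge0].
rewrite -lee_fin.
apply: le_trans (fL _ _ (truncate_finite a_gt0 _ _) (truncate_finite a_gt0 _ _)) _.
rewrite EFinM; apply: lee_wpmul2l; first by rewrite lee_fin ltW.
exact: cdist_move.
Qed.

(** The bound by [activity] holds for all truncations at once, which gives the
    dominated convergence of the generator along truncations. *)
Lemma truncated_generator f L eta : lipschitz_with a X L f -> X eta ->
  (forall n, (`|generator p g (fun zeta => f (truncate n zeta)) eta|%:E
     <= (L * C * (2 + M))%:E * cnorm a eta)%E) /\
  generator p g (fun zeta => f (truncate n zeta)) eta @[n --> \oo]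
    --> generator p g f eta.
Proof.
move=> fL Xeta; have L0 : 0 <= L by case: fL => /ltW.
have afin : (\esum_(i in [set: lattice d * lattice d * nat])
    (activity L eta i)%:E < +oo)%E.
  apply: le_lt_trans (activity_le eta L0) _.
  move: Xeta (cnorm_ge0 a_gt0 eta); rewrite /X /finite_confs /=.
  by case: (cnorm a eta) => // r _ _; rewrite -EFinM ltry.
split=> [n|].
  apply: le_trans (activity_le eta L0).
  by apply: rsum_le => // i; exact: truncated_generator_summand.
apply: (rsum_dominated (v := activity L eta)) => //.
  by move=> n i; exact: truncated_generator_summand.
move=> [[x y] k]; apply: cvgMr; apply: cvgB.
  by apply: lipschitz_truncate_cvg fL _ => //; exact: move_finite.
exact: lipschitz_truncate_cvg fL Xeta.
Qed.

Section Expectation.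
Variables (nu : probability (confM d) R) (mu : nat -> R).
Hypothesis nu_prod : product_measure nu.
Hypothesis nu_marg : site_marginal nu mu.
Hypothesis mu_gt0 : forall n, 0 < mu n.
Hypothesis mu_moment : finite_first_moment mu.

(** The norm has expectation (first moment of [mu]) times (sum of [a]); in
    particular almost every configuration has finite norm. *)
Lemma expected_cnorm_fin : (\int[nu]_eta cnorm a eta < +oo)%E.
Proof.
have mom0 : (0 <= \sum_(n <oo) (n%:R * mu n)%:E)%E.
  by apply: nneseries_ge0 => n _ _; rewrite lee_fin mulr_ge0// ltW.
rewrite integral_esum//; last 2 first.
- by move=> x; exact: (measurable_coordinate_fun (fun n => n%:R * a x)).
- by move=> x eta; rewrite lee_fin mulr_ge0.
have -> : (\esum_(x in [set: lattice d]) \int[nu]_eta ((eta x)%:R * a x)%:E =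
  (fine (\sum_(n <oo) (n%:R * mu n)%:E))%:E * \esum_(x in [set: lattice d]) (a x)%:E)%E.
  rewrite -esumZl ?fine_ge0//; last by move=> x _; rewrite lee_fin.
  apply: eq_esum => x _.
  rewrite (expected_coordinate nu_prod nu_marg mu_gt0 (q := fun n => n%:R * a x));
    last by move=> n; rewrite mulr_ge0.
  rewrite fineK ?ge0_fin_numE// muleC -nneseriesZl; last first.
    by move=> n _; rewrite lee_fin mulr_ge0// ltW.
  by apply: eq_eseriesr => n _; rewrite -EFinM; congr EFin; ring.
have : (0 <= \esum_(x in [set: lattice d]) (a x)%:E)%E.
  by apply: esum_ge0 => x _; rewrite lee_fin.
have [_ _ _] := a_adm.
by case: (esum _ _) => // r _ _; rewrite -EFinM ltry.
Qed.

Lemma integrable_cnorm : nu.-integrable setT (cnorm a).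
Proof.
apply/integrableP; split; first exact: measurable_cnorm.
under eq_integral do rewrite gee0_abs ?cnorm_ge0//.
exact: expected_cnorm_fin.
Qed.

Lemma finite_confs_compl_null : nu (~` X) = 0%E.
Proof.
have [N [mN N0 sub]] := integrable_ae measurableT integrable_cnorm.
apply: (subset_measure0 (mu := nu) _ mN _ N0).
  by apply: measurableC; exact: measurable_finite_confs.
move=> eta /= nX; apply: sub => /= /(_ I) fin; apply: nX.
by rewrite /X /finite_confs/= -ge0_fin_numE// cnorm_ge0.
Qed.

Lemma finite_confs_full : nu X = 1%E.
Proof.
have mX := measurable_finite_confs a_gt0.
have := @probability_setC _ _ _ nu _ (measurableC mX).
by rewrite setCK finite_confs_compl_null sube0.
Qed.

Lemma integral_finite_confs (F : confM d -> \bar R) : nu.-integrable setT F ->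
  (\int[nu]_(eta in (X : set (confM d))) F eta = \int[nu]_eta F eta)%E.
Proof.
move=> iF; rewrite [RHS](@negligible_integral _ _ _ nu setT (~` X))//.
- by rewrite setDE setCK setTI.
- by apply: measurableC; exact: measurable_finite_confs.
- exact: finite_confs_compl_null.
Qed.

Lemma integrable_cnormZ (K : R) :
  nu.-integrable (X : set (confM d)) (fun eta => (K%:E * cnorm a eta)%E).
Proof.
apply: integrableZl; first exact: measurable_finite_confs.
apply: integrableS integrable_cnorm => //.
exact: measurable_finite_confs.
Qed.

Lemma balanced_Lip_expectation0 f (B : R) : balanced mu gs -> Lip a X f ->
  (forall eta, X eta -> `|f eta| <= B) ->
  (\int[nu]_(eta in (X : set (confM d))) (generator p g f eta)%:E = 0)%E.
Proof.
move=> bal [L fL] fB.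
have w_fin := linear_weight_fin mu_gt0 mu_moment C0.
have suf n := @balanced_sufficient _ _ _ p_prob p_transl _ _ nu_prod nu_marg
  mu_gt0 _ gs_ge0 (fun n => C * n%:R) (fun n => mulr_ge0 (ltW C0) (ler0n _ n))
  growth_out_rate w_fin (fun zeta => f (truncate n zeta)) B bal
  (ex_intro _ (window d n) (@truncate_depends d n _ f))
  (fun eta => fB _ (truncate_finite a_gt0 n eta)).
have mX := measurable_finite_confs a_gt0.
have mgn n : measurable_fun (X : set (confM d))
    (generator p g (fun zeta => f (truncate n zeta)) : confM d -> R).
  apply: measurable_funTS; apply/measurable_EFinP.
  by have [/integrableP[]] := suf n.
have mg : measurable_fun (X : set (confM d)) (generator p g f : confM d -> R).
  apply: (measurable_fun_cvg
    (h := fun n (eta : confM d) =>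
       generator p g (fun zeta => f (truncate n zeta)) eta)) => // eta Xeta.
  by have [] := truncated_generator fL Xeta.
have [] := @dominated_convergence _ _ _ nu X mX
  (fun n eta => (generator p g (fun zeta => f (truncate n zeta)) eta)%:E)
  (fun eta => (generator p g f eta)%:E)
  (fun eta => (L * C * (2 + M))%:E * cnorm a eta)%E.
- by move=> n; apply/measurable_EFinP; exact: mgn.
- exact/measurable_EFinP.
- apply: aeW => eta Xeta; apply/fine_cvgP; split; first exact: nearW.
  by have [] := truncated_generator fL Xeta.
- exact: integrable_cnormZ.
- apply: aeW => eta n Xeta.
  by have [/(_ n)] := truncated_generator fL Xeta.
move=> _ _ /cvg_lim <- //; apply: lim_near_cst => //; apply: nearW => n.
exact: etrans (integral_finite_confs (suf n).1) (suf n).2.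
Qed.

Lemma bounded_integrable f (B : R) : Lip a X f -> (forall eta, X eta -> `|f eta| <= B) ->
  nu.-integrable (X : set (confM d)) (EFin \o (f : confM d -> R)).
Proof.
move=> lf fB; have mX := measurable_finite_confs a_gt0.
apply/integrableP; split; first by apply/measurable_EFinP; exact: Lip_measurable.
apply: (@le_lt_trans _ _ (\int[nu]_(eta in (X : set (confM d))) (cst B%:E) eta)%E).
  apply: ge0_le_integral => //.
  - apply: measurableT_comp => //; apply/measurable_EFinP; exact: Lip_measurable.
by rewrite integral_cst// [X in (_ * X)%E]finite_confs_full mule1 ltry.
Qed.

End Expectation.
End Activity.

(** * Invariance and the expectation of the generator *)

(** [1 - x <= expR (- x)] multiplied by [expR x] gives
    [expR x - 1 <= x * expR x]. *)
Lemma expR_growth_le (R : realType) (c h : R) : 0 < c -> 0 < h <= 1 ->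
  (expR (c * h) - 1) / h <= c * expR c.
Proof.
move=> c0 /andP[h0 h1].
have e0 : 0 < expR (c * h) by exact: expR_gt0.
have := expR_ge1Dx (- (c * h)); rewrite expRN => e1.
have e2 : (1 - c * h) * expR (c * h) <= 1.
  by have := ler_wpM2r (ltW e0) e1; rewrite mulVf ?gt_eqF.
rewrite ler_pdivrMr//.
apply: (@le_trans _ _ (c * h * expR (c * h))); first by lra.
rewrite mulrAC ler_wpM2r ?(ltW h0)// ler_wpM2l ?(ltW c0)// ler_expR.
by rewrite ger_pMr.
Qed.

Section Semigroup.
Variables (R : realType) (d : nat) (p : lattice d -> lattice d -> R).
Hypothesis p_prob : transition_probability p.
Hypothesis p_transl : translation_invariant_kernel p.
Variables (a : lattice d -> R) (M : R).
Hypothesis a_adm : admissible_weight p a M.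
Variables (nu : probability (confM d) R) (mu : nat -> R).
Hypothesis nu_prod : product_measure nu.
Hypothesis nu_marg : site_marginal nu mu.
Hypothesis mu_gt0 : forall n, 0 < mu n.
Hypothesis mu_moment : finite_first_moment mu.
Variable g : nat -> nat -> nat -> R.
Variable S : R -> (conf d -> R) -> (conf d -> R).
Hypothesis con : constructed_on_X p a g S.
Implicit Types (eta zeta : conf d) (f : conf d -> R).

Let X := finite_confs a.

Let a_gt0 x : 0 < a x. Proof. by case: a_adm. Qed.

Let mX : measurable (X : set (confM d)).
Proof. exact: measurable_finite_confs. Qed.

Let mLip f : Lip a X f -> measurable_fun (X : set (confM d)) (f : confM d -> R).
Proof. exact: Lip_measurable. Qed.

(** Positivity applied to [B - f] and [B + f]. The constant [B] is written as
    [(B - 1) * 1 + 1] to be a combination of the constant [1], on which the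
    semigroup is known. *)
Lemma semigroup_bounded f (B t : R) : Lip a X f -> 0 <= t ->
  (forall eta, X eta -> `|f eta| <= B) ->
  forall eta, X eta -> `|S t f eta| <= B.
Proof.
move=> lf t0 fB eta Xeta.
have [D [ms LD _]] := con_markov con.
have D1 := msg_dom1 ms; have Df := LD _ lf.
pose k zeta : R := (B - 1) * 1 + 1.
have Dk : D k by exact: (msg_domP ms (B - 1) D1 D1).
have Sk : S t k eta = B.
  rewrite /k (msg_linear ms (B - 1) t0 D1 D1 Xeta) (msg_1 ms t0 Xeta); ring.
have up : 0 <= S t (fun zeta => -1 * f zeta + k zeta) eta.
  apply: (msg_pos ms t0 _ _ Xeta); first exact: (msg_domP ms (-1) Df Dk).
  by move=> zeta /fB; rewrite /k ler_norml; lra.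
have down : 0 <= S t (fun zeta => 1 * f zeta + k zeta) eta.
  apply: (msg_pos ms t0 _ _ Xeta); first exact: (msg_domP ms 1 Df Dk).
  by move=> zeta /fB; rewrite /k ler_norml; lra.
move: up down; rewrite !(msg_linear ms _ t0 Df Dk Xeta) Sk ler_norml; lra.
Qed.

(** The bound on [S t f - f] dominates the difference quotients by a multiple of
    the norm, uniformly for times at most one. *)
Lemma expected_difference_quotient f (h : nat -> R) : Lip a X f ->
  (forall n, 0 < h n <= 1) -> h n @[n --> \oo] --> (0 : R) ->
  (\int[nu]_(eta in (X : set (confM d))) ((S (h n) f eta - f eta) / h n)%:E
     @[n --> \oo] -->
   \int[nu]_(eta in (X : set (confM d))) (generator p g f eta)%:E)%E.
Proof.
move=> lf h01 hcvg.
have h0 n : 0 < h n by case/andP: (h01 n).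
have lSf n : Lip a X (S (h n) f) by apply: (con_stable con) => //; exact: ltW.
pose F n (eta : confM d) : R := (S (h n) f eta - f eta) / h n.
have mF n : measurable_fun (X : set (confM d)) (F n).
  apply: measurable_funM; last exact: measurable_cst.
  by apply: measurable_funB; exact: mLip.
have Fcvg eta : X eta -> F n eta @[n --> \oo] --> generator p g f eta.
  move=> Xeta; have /cvg_at_rightP := con_derivative con lf Xeta.
  by apply; split.
have mgen : measurable_fun (X : set (confM d)) (generator p g f : confM d -> R).
  exact: (measurable_fun_cvg (h := F)).
have [c c0 growth] := con_growth con.
have [L fL] := lf; have L0 : 0 <= L by case: fL => /ltW.
have [] := @dominated_convergence _ _ _ nu X mX (fun n eta => (F n eta)%:E)
  (fun eta => (generator p g f eta)%:E)
  (fun eta => (L * (c * expR c))%:E * cnorm a eta)%E.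
- by move=> n; apply/measurable_EFinP.
- exact/measurable_EFinP.
- apply: aeW => eta Xeta; apply/fine_cvgP; split; first exact: nearW.
  exact: Fcvg.
- exact: (integrable_cnormZ a_adm nu_prod nu_marg mu_gt0).
- apply: aeW => eta n Xeta; rewrite abse_EFin /F normf_div (ger0_norm (ltW (h0 n))).
  rewrite mulrC EFinM.
  apply: (@le_trans _ _
    ((h n)^-1%:E * (cnorm a eta * (L * (expR (c * h n) - 1))%:E))%E).
    apply: lee_wpmul2l; first by rewrite lee_fin invr_ge0 ltW.
    by apply: growth => //; exact: ltW.
  rewrite muleCA muleC -EFinM; apply: lee_wpmul2r; first exact: cnorm_ge0.
  rewrite lee_fin mulrCA ler_wpM2l// mulrC.
  exact: expR_growth_le.
by [].
Qed.

Lemma expected_quotientE f f' (B h : R) : Lip a X f -> Lip a X f' ->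
  (forall eta, X eta -> `|f eta| <= B) -> (forall eta, X eta -> `|f' eta| <= B) ->
  (\int[nu]_(eta in (X : set (confM d))) ((f' eta - f eta) / h)%:E =
   ((fine (\int[nu]_(eta in (X : set (confM d))) (f' eta)%:E) -
     fine (\int[nu]_(eta in (X : set (confM d))) (f eta)%:E)) / h)%:E)%E.
Proof.
move=> lf lf' fB f'B.
have i1 := bounded_integrable a_adm nu_prod nu_marg mu_gt0 mu_moment lf fB.
have i2 := bounded_integrable a_adm nu_prod nu_marg mu_gt0 mu_moment lf' f'B.
have i3 : nu.-integrable (X : set (confM d)) (fun eta => (f' eta - f eta)%:E).
  exact: (integrableB mX i2 i1).
under eq_integral do rewrite mulrC EFinM.
rewrite integralZl//.
under eq_integral do rewrite EFinB.
rewrite integralB// mulrC EFinM EFinB !fineK//; exact: integrable_fin_num.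
Qed.

Lemma invariant_expectation0 f (B : R) : invariant_on_X a S nu -> Lip a X f ->
  (forall eta, X eta -> `|f eta| <= B) ->
  (\int[nu]_(eta in (X : set (confM d))) (generator p g f eta)%:E = 0)%E.
Proof.
move=> [_ inv] lf fB.
pose h n : R := n.+1%:R^-1.
have h01 n : 0 < h n <= 1 by rewrite invr_gt0 ltr0n invf_le1// ler1n.
have lim := expected_difference_quotient lf h01 (@inv_succ_cvg0 R).
rewrite -(cvg_lim _ lim)//; apply: lim_near_cst => //; apply: nearW => n.
have hn0 : 0 <= h n by case/andP: (h01 n) => /ltW.
rewrite (expected_quotientE (h n) lf (con_stable con hn0 lf) fB); last first.
  exact: semigroup_bounded.
by rewrite (inv f _ _ hn0) ?subrr ?mul0r//; split=> //; exists B.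
Qed.

(** Since [S (s + h) f = S h (S s f)], the right derivative of the expectation of
    [S s f] at [s] is the expectation of the generator at [S s f]. Working
    with right derivatives keeps [s] fixed, so that only the Lipschitz constant
    of the single function [S s f] enters the domination. *)
Lemma generator_expectation0_invariant :
  (forall f (B : R), Lip a X f -> (forall eta, X eta -> `|f eta| <= B) ->
    (\int[nu]_(eta in (X : set (confM d))) (generator p g f eta)%:E = 0)%E) ->
  invariant_on_X a S nu.
Proof.
move=> gen0; split; first exact: (finite_confs_full a_adm nu_prod nu_marg mu_gt0).
move=> f [lf [B fB]] t t0.
have [D [ms LD _]] := con_markov con.
pose u s : R := fine (\int[nu]_(eta in (X : set (confM d))) (S s f eta)%:E)%E.
have lS s : 0 <= s -> Lip a X (S s f) by move=> s0; exact: (con_stable con).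
have SB s : 0 <= s -> forall eta, X eta -> `|S s f eta| <= B.
  by move=> s0; exact: semigroup_bounded.
have Sfin s : 0 <= s ->
    (\int[nu]_(eta in (X : set (confM d))) (S s f eta)%:E)%E = (u s)%:E.
  move=> s0; rewrite /u fineK//; apply: integrable_fin_num => //.
  exact: (bounded_integrable a_adm nu_prod nu_marg mu_gt0 mu_moment (lS s s0) (SB s s0)).
have u_right (s : R) (h : nat -> R) : 0 <= s -> (forall n, 0 < h n <= 1) ->
    h n @[n --> \oo] --> (0 : R) ->
    (u (s + h n) - u s) / h n @[n --> \oo] --> (0 : R).
  move=> s0 h01 hcvg.
  have := expected_difference_quotient (lS s s0) h01 hcvg.
  rewrite (gen0 _ B (lS s s0) (SB s s0)) => /fine_cvgP[_].
  apply: cvg_trans; apply: near_eq_cvg; apply: nearW => n /=.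
  have h0 : 0 <= h n by case/andP: (h01 n) => /ltW.
  have sh0 : 0 <= s + h n by rewrite addr_ge0.
  rewrite (_ : (\int[nu]_(eta in _) _)%E =
      \int[nu]_(eta in (X : set (confM d))) ((S (s + h n) f eta - S s f eta) / h n)%:E)%E.
    by rewrite (expected_quotientE _ (lS s s0) (lS _ sh0) (SB s s0) (SB _ sh0)).
  apply: eq_integral => eta; rewrite inE => Xeta.
  by rewrite (addrC s) (msg_add ms h0 s0 (LD _ lf) Xeta).
have u_cont (s : R) (r : nat -> R) : 0 <= s -> (forall n, 0 <= r n) ->
    r n @[n --> \oo] --> s -> u (r n) @[n --> \oo] --> u s.
  move=> s0 r0 rcvg.
  have [] := @dominated_convergence _ _ _ nu X mX
    (fun n (eta : confM d) => (S (r n) f eta)%:E) (fun eta => (S s f eta)%:E)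
    (cst B%:E).
  - by move=> n; apply/measurable_EFinP; apply: mLip; exact: lS.
  - by apply/measurable_EFinP; apply: mLip; exact: lS.
  - apply: aeW => eta Xeta; apply/fine_cvgP; split; first exact: nearW.
    have /subspace_continuousP/(_ s) := con_continuous con lf Xeta.
    rewrite /= in_itv/= s0 => /(_ isT) h.
    apply: (cvg_comp _ _ _ h) => P /=.
    rewrite /within/= => /rcvg; rewrite /nbhs/= /nbhs/=; apply: filterS => n /=.
    by apply; rewrite in_itv/= r0.
  - apply/integrableP; split; first exact: measurable_cst.
    rewrite (_ : (fun x : confM d => `|cst B%:E x|) = cst (`|B|%:E))%E//.
    rewrite integral_cst// [X in (_ * X)%E](_ : _ = 1%E) ?mule1 ?ltry//.
    exact: (finite_confs_full a_adm nu_prod nu_marg mu_gt0).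
  - by apply: aeW => eta n Xeta; rewrite lee_fin SB.
  by move=> _ _; rewrite Sfin// => /fine_cvgP[].
rewrite Sfin// (zero_right_derivative_cst u_right u_cont t0) -Sfin//.
by apply: eq_integral => eta; rewrite inE => Xeta; rewrite (msg_0 ms (LD _ lf) Xeta).
Qed.

End Semigroup.

(** * The characterization of invariant product measures *)

Theorem theorem3p15 (R : realType) (d : nat)
  (p : lattice d -> lattice d -> R)
  (p_prob : transition_probability p)
  (p_irr : irreducible_kernel p)
  (p_transl : translation_invariant_kernel p)
  (p_asym : asymmetric_kernel p)
  (a : lattice d -> R) (M : R)
  (a_adm : admissible_weight p a M)
  (gs : nat -> nat -> R)
  (gs_ge0 : forall k beta, (0 < k)%N -> 0 <= gs k beta)
  (S : R -> (conf d -> R) -> (conf d -> R))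
  (mubar : probability (confM d) R) (mu : nat -> R)
  (mubar_prod : product_measure mubar)
  (mubar_transl : translation_invariant_measure mubar)
  (mubar_marg : site_marginal mubar mu)
  (mu_gt0 : forall alpha, 0 < mu alpha)
  (H : nat -> nat -> nat -> R)
  (H_rec : H_recurrence mu H) :
  let g := MMTP_rates gs in
  let rate_relation :=
    forall alpha beta, (1 <= alpha)%N -> (1 <= beta)%N ->
      gs alpha beta = gs alpha 0%N
        + (mu beta)^-1 * \sum_(1 <= k < beta.+1) H alpha beta k * gs k 0%N in
  (MMTP_growth gs -> finite_first_moment mu -> constructed_on_X p a g S ->
     (invariant_on_X a S mubar <-> rate_relation)) /\
  (assumption_A1 p a g S -> assumption_A2 g ->
     (invariant_on_conf a S mubar <-> rate_relation)).
Proof.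
move=> g rate_relation.
have rateP : rate_relation <-> balanced mu gs.
  by split=> [/(balanced_rate_relation gs mu_gt0 H_rec)|
              /(balanced_rate_relation gs mu_gt0 H_rec)].
rewrite rateP; split.
- move=> [C C0 growth] moment con.
  have a_gt0 x : 0 < a x by case: a_adm.
  have w_ge0 n : 0 <= C * n%:R by rewrite mulr_ge0// ltW.
  have out_le := growth_out_rate gs_ge0 C0 growth.
  have w_fin := linear_weight_fin mu_gt0 moment C0.
  split=> [inv|bal].
    apply: (balanced_necessary p_prob p_transl mubar_prod mubar_marg mu_gt0
      gs_ge0 w_ge0 out_le w_fin p_asym) => t xi ut.
    have ind01 eta : 0 <= (\1_(cylinder_event t xi) : conf d -> R) eta <= 1.
      by rewrite indicE; case: (_ \in _); rewrite ?lexx ler01.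
    have [_ _ int_gen _] := generator_expectation p_prob p_transl mubar_prod
      mubar_marg mu_gt0 gs_ge0 w_ge0 out_le w_fin ut ind01 (@depends_on_cylinder R d t xi).
    apply: etrans (esym (integral_finite_confs a_adm mubar_prod mubar_marg mu_gt0
      moment int_gen)) _.
    apply: (invariant_expectation0 a_adm mubar_prod mubar_marg mu_gt0 moment
      con inv (B := 1)); first exact: cylinder_event_Lip.
    by move=> eta _; have /andP[i0 i1] := ind01 eta; rewrite ger0_norm.
  apply: (generator_expectation0_invariant a_adm mubar_prod mubar_marg mu_gt0
    moment con) => f B lf fB.
  exact: (balanced_Lip_expectation0 p_prob p_transl a_adm gs_ge0 C0 growth
    mubar_prod mubar_marg mu_gt0 moment bal lf fB).
- move=> [_ A1] [C C0 A2]; rewrite A1.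
  pose w (n : nat) := C; have w_ge0 n : 0 <= w n by exact: ltW.
  have out_le al be : out_rate gs al be <= w al + w be.
    rewrite -[out_rate _ _ _]add0r lerD ?(ltW C0)//.
    apply: le_trans (A2 al be).
    rewrite big_nat_recl// /g /MMTP_rates/= add0r /out_rate big_add1/=.
    rewrite big_nat_cond [leRHS]big_nat_cond ler_sum// => k.
    by rewrite andbT => /andP[_ ->].
  have w_fin : (\sum_(n <oo) (mu n * w n)%:E < +oo)%E.
    exact: constant_weight_fin mubar_marg C0.
  split=> [inv|bal f cf [B fB]].
    apply: (balanced_necessary p_prob p_transl mubar_prod mubar_marg mu_gt0
      gs_ge0 w_ge0 out_le w_fin p_asym) => t xi ut; apply: inv.
      by exists t; exact: depends_on_cylinder.
    exists 1 => eta _; rewrite indicE; case: (_ \in _); rewrite ?normr1 ?normr0//.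
  by have [] := balanced_sufficient p_prob p_transl mubar_prod mubar_marg mu_gt0
    gs_ge0 w_ge0 out_le w_fin bal cf (fun eta => fB eta I).
Qed.
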